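(* Let $K=\mathbb{Q}(\sqrt2,\sqrt3)\subset\mathbb{R}$, and let $U\in M_6(K)$ be the matrix $$ U=\begin{bmatrix} -\frac{\sqrt6}{6} & -\frac{\sqrt6}{6} & -\frac{\sqrt6}{6} & -\frac{\sqrt6}{6} & -\frac{\sqrt6}{6} & -\frac{\sqrt6}{6}\\ -\frac{\sqrt3}{3} & 0 & -\frac12 & \frac{\sqrt3}{6} & \frac{\sqrt3}{6} & \frac12\\ 0 & -\frac{\sqrt3}{3} & \frac{\sqrt3}{6} & -\frac12 & \frac12 & \frac{\sqrt3}{6}\\ 0 & -\frac{\sqrt3}{3} & \frac{\sqrt3}{6} & \frac12 & -\frac12 & \frac{\sqrt3}{6}\\ -\frac{\sqrt3}{3} & 0 & \frac12 & \frac{\sqrt3}{6} & \frac{\sqrt3}{6} & -\frac12\\ -\frac{\sqrt6}{6} & \frac{\sqrt6}{6} & \frac{\sqrt6}{6} & -\frac{\sqrt6}{6} & -\frac{\sqrt6}{6} & \frac{\sqrt6}{6} \end{bmatrix} $$ (the unitary discrete Fourier transform matrix of the symmetric group $S_3$). Its characteristic polynomial is $$ \begin{aligned} f(x)={}&x^6-\Bigl(\tfrac{\sqrt3}{3}+\tfrac12\Bigr)x^5+\Bigl(\bigl(-\tfrac{\sqrt2}{6}+\tfrac16\bigr)\sqrt3-\tfrac{\sqrt2}{3}-\tfrac13\Bigr)x^4+\Bigl(\bigl(\tfrac{\sqrt2}{3}+\tfrac13\bigr)\sqrt3+\tfrac{\sqrt2}{2}\Bigr)x^3\\ &+\Bigl(\bigl(-\tfrac{\sqrt2}{6}+\tfrac16\bigr)\sqrt3-\tfrac{\sqrt2}{3}-\tfrac13\Bigr)x^2-\Bigl(\tfrac{\sqrt3}{3}+\tfrac12\Bigr)x+1\in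 K[x]. \end{aligned} $$ Let $L$ be the splitting field of $f$ over $K$. Then $[L:\mathbb{Q}]=192$, $[L:K]=48$, and $\mathrm{Gal}(L/K)$, regarded as a permutation group on the six roots of $f$, is the wreath product $S_2\wr S_3$ in its transitive action on six points (the roots are partitioned into three pairs; $S_3$ permutes the pairs, and each pair can be swapped internally by a copy of $S_2$).
   Context: $S_2\wr S_3=(S_2)^3\rtimes S_3$ denotes the wreath product of order $48$, where $S_3$ permutes the three copies of $S_2$; it acts on six points as the full stabilizer in $S_6$ of a partition of the six points into three pairs. The square roots $\sqrt2,\sqrt3$ are the positive real ones and $\sqrt6=\sqrt2\sqrt3$. *)

(* Defs.v *)
From HB Require Import structures.
From mathcomp Require Import all_boot all_order all_algebra all_fingroup.
From mathcomp Require Import all_solvable all_field.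
From mathcomp Require Import reals.

Set Implicit Arguments.
Unset Strict Implicit.
Unset Printing Implicit Defensive.

Import Order.TTheory GRing.Theory Num.Theory GroupScope.

Section Wreath.

(* The point (i, j) is the j-th element of the i-th pair. *)
Notation point := ('I_3 * 'I_2)%type.
Implicit Types (b : {ffun 'I_3 -> 'S_2}) (t : 'S_3) (s : {perm 'I_3 * 'I_2}).

Definition wr_fun b t (p : point) : point := (t p.1, b p.1 p.2).

Lemma wr_fun_inj b t : injective (wr_fun b t).
Proof.
move=> [i j] [k l] [/perm_inj eik].
by rewrite eik => /perm_inj ->.
Qed.

Definition wr_perm b t : {perm point} := perm (@wr_fun_inj b t).

Lemma wr_permE b t p : wr_perm b t p = (t p.1, b p.1 p.2).
Proof. by rewrite permE. Qed.

(* Products of permutations are read from left to right. *)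
Lemma wr_permM b t c u :
  wr_perm b t * wr_perm c u = wr_perm [ffun i => b i * c (t i)] (t * u).
Proof. by apply/permP=> -[i j]; rewrite permM !wr_permE /= ffunE !permM. Qed.

Lemma wr_perm_inj b t c u : wr_perm b t = wr_perm c u -> b = c /\ t = u.
Proof.
move=> e; split; last first.
  by apply/permP=> i; have /(congr1 (fun s => s (i, ord0))) := e;
    rewrite !wr_permE => -[].
apply/ffunP=> i; apply/permP=> j.
by have /(congr1 (fun s => s (i, j))) := e; rewrite !wr_permE => -[].
Qed.

Definition S2wrS3 : {set {perm point}} :=
  [set wr_perm b t | b : {ffun 'I_3 -> 'S_2}, t : 'S_3].

Lemma S2wrS3P s : reflect (exists b t, s = wr_perm b t) (s \in S2wrS3).
Proof.
apply: (iffP imset2P) => [[b t _ _ ->]|[b [t ->]]]; first by exists b, t.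
by exists b t.
Qed.

Lemma wr_perm1 : wr_perm [ffun=> 1] 1 = 1.
Proof. by apply/permP=> -[i j]; rewrite wr_permE ffunE !perm1. Qed.

Lemma S2wrS3_group_set : group_set S2wrS3.
Proof.
apply/group_setP; split; first by rewrite -wr_perm1; apply/S2wrS3P; do 2!eexists.
move=> _ _ /S2wrS3P[b [t ->]] /S2wrS3P[c [u ->]].
by rewrite wr_permM; apply/S2wrS3P; do 2!eexists.
Qed.
Canonical S2wrS3_group := Group S2wrS3_group_set.

Lemma card_S2wrS3 : #|S2wrS3| = 48.
Proof.
have -> : S2wrS3 = [set wr_perm x.1 x.2 | x : {ffun 'I_3 -> 'S_2} * 'S_3].
  apply/setP=> s; apply/S2wrS3P/imsetP => [[b [t ->]]|[[b t] _ ->]].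
    by exists (b, t).
  by exists b, t.
rewrite card_imset; last by move=> [b t] [c u] /wr_perm_inj[/= -> ->].
by rewrite card_prod card_ffun !card_Sn card_ord.
Qed.

Lemma S2wrS3_trans : [transitive S2wrS3, on [set: point] | 'P].
Proof.
apply/imsetP; exists (ord0, ord0); rewrite ?inE //; apply/esym/setP=> -[i j].
rewrite inE; apply/imsetP.
exists (wr_perm [ffun=> tperm ord0 j] (tperm ord0 i)).
  by apply/S2wrS3P; do 2!eexists.
by rewrite /= apermE wr_permE ffunE !tpermL.
Qed.

(* The base group (S_2)^3 and the complement S_3 permuting its factors. *)
Definition wr_base (b : {dffun forall _ : 'I_3, 'S_2}) : {perm point} :=
  wr_perm [ffun i => b i] 1.

Lemma wr_base_morphM : {morph wr_base : b c / b * c}.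
Proof.
move=> b c; rewrite /wr_base wr_permM mulg1; congr wr_perm.
by apply/ffunP=> i; rewrite !ffunE perm1.
Qed.
Canonical wr_base_morphism := @Morphism _ _ setT _ (in2W wr_base_morphM).

Lemma injm_wr_base : 'injm wr_base.
Proof.
apply/injmP=> b c _ _ /wr_perm_inj[/ffunP e _].
by apply/ffunP=> i; have := e i; rewrite !ffunE.
Qed.

Definition wr_top t : {perm point} := wr_perm [ffun=> 1] t.

Lemma wr_top_morphM : {morph wr_top : t u / t * u}.
Proof.
move=> t u; rewrite /wr_top wr_permM; congr wr_perm.
by apply/ffunP=> i; rewrite !ffunE mulg1.
Qed.
Canonical wr_top_morphism := @Morphism _ _ setT _ (in2W wr_top_morphM).

Lemma injm_wr_top : 'injm wr_top.
Proof. by apply/injmP=> t u _ _ /wr_perm_inj[]. Qed.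

Lemma S2wrS3_sdprod :
  (wr_base @* [set: {dffun forall _ : 'I_3, 'S_2}]) ><| (wr_top @* [set: 'S_3])
    = S2wrS3.
Proof.
have baseP x : reflect (exists b, x = wr_perm b 1) (x \in wr_base @* setT).
  rewrite morphimEdom; apply: (iffP imsetP) => [[b _ ->]|[b ->]].
    by eexists.
  exists [ffun i => b i] => //; congr wr_perm.
  by apply/ffunP=> i; rewrite !ffunE.
have topP x : reflect (exists t, x = wr_top t) (x \in wr_top @* setT).
  by rewrite morphimEdom; apply: (iffP imsetP) => [[t _ ->]|[t ->]]; exists t.
rewrite sdprodE.
- apply/setP=> s; apply/idP/S2wrS3P.
    case/mulsgP=> _ _ /baseP[b ->] /topP[t ->] ->.
    by rewrite wr_permM; do 2!eexists.
  case=> b [t ->]; apply/mulsgP; exists (wr_perm b 1) (wr_top t).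
  + by apply/baseP; exists b.
  + by apply/topP; exists t.
  rewrite wr_permM mul1g; congr wr_perm.
  by apply/ffunP=> i; rewrite !ffunE mulg1.
- apply/subsetP=> _ /topP[t ->]; rewrite inE.
  apply/subsetP=> _ /imsetP[_ /baseP[b ->] ->].
  rewrite /conjg -morphV ?inE //= /wr_top !wr_permM mul1g mulVg.
  by apply/baseP; eexists.
apply/trivgP/subsetP=> _ /setIP[/baseP[b ->] /topP[t /wr_perm_inj[-> _]]].
by rewrite wr_perm1 inE.
Qed.

Definition pairs : {set {set point}} :=
  [set [set (i, j) | j : 'I_2] | i : 'I_3].

Lemma S2wrS3_stabilizer : S2wrS3 = 'N(pairs | ('P^*)%act).
Proof.
have mem_pair (i k : 'I_3) (j : 'I_2) :
    ((k, j) \in [set (i, j') | j' : 'I_2]) = (k == i).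
  apply/imsetP/eqP => [[j' _ [->]]//|->]; by exists j.
apply/setP=> s; apply/S2wrS3P/idP.
  case=> b [t ->]; rewrite 3!inE /=.
  apply/subsetP=> _ /imsetP[i _ ->]; rewrite inE /=; apply/imsetP.
  exists (t i) => //; rewrite /setact; apply/setP=> -[k l]; rewrite mem_pair.
  apply/imsetP/eqP => [[[i' j']]|->].
    by rewrite mem_pair => /eqP -> /=; rewrite apermE wr_permE => -[].
  exists (i, (b i)^-1 l); first by rewrite mem_pair.
  by rewrite /= apermE wr_permE /= permKV.
rewrite 3!inE => /subsetP sP.
have stab (i : 'I_3) (j j' : 'I_2) : (s (i, j)).1 = (s (i, j')).1.
  have := sP [set (i, j) | j : 'I_2]; rewrite imset_f // inE /= => /(_ isT).
  case/imsetP=> k _ /setP e.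
  suff key l : (s (i, l)).1 = k by rewrite !key.
  have := e (s (i, l)); rewrite [s (i, l)]surjective_pairing mem_pair /=.
  rewrite -surjective_pairing => h; apply/eqP; rewrite -h.
  by apply/imsetP; exists (i, l); rewrite ?mem_pair ?apermE.
have b_inj i : injective (fun j => (s (i, j)).2).
  move=> j j' /= e; suff /perm_inj[]: s (i, j) = s (i, j') by [].
  by rewrite [LHS]surjective_pairing [RHS]surjective_pairing e (stab i j j').
have t_inj : injective (fun i => (s (i, ord0)).1).
  move=> i i' /= e.
  have /codomP[j ej] : (s (i', ord0)).2 \in codom (fun j => (s (i, j)).2).
    by have [g gK Kg] := injF_bij (b_inj i); rewrite -[X in X \in _]Kg; apply: codom_f.
  suff /perm_inj[]: s (i, j) = s (i', ord0) by [].
  by rewrite [LHS]surjective_pairing [RHS]surjective_pairing -ej -e (stab i j ord0).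
exists [ffun i => perm (@b_inj i)], (perm t_inj).
apply/permP=> -[i j]; rewrite wr_permE /= ffunE !permE /= (stab i ord0 j).
exact: surjective_pairing.
Qed.

End Wreath.

Local Open Scope ring_scope.

(* s2 and s3 stand for the square roots of 2 and 3. *)
Definition dftS3 (F : fieldType) (s2 s3 : F) : 'M[F]_6 :=
  let s6 := s2 * s3 in
  let rows : seq (seq F) :=
  [:: [:: - (s6 / 6); - (s6 / 6); - (s6 / 6); - (s6 / 6); - (s6 / 6); - (s6 / 6)];
      [:: - (s3 / 3); 0; - (1 / 2); s3 / 6; s3 / 6; 1 / 2];
      [:: 0; - (s3 / 3); s3 / 6; - (1 / 2); 1 / 2; s3 / 6];
      [:: 0; - (s3 / 3); s3 / 6; 1 / 2; - (1 / 2); s3 / 6];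
      [:: - (s3 / 3); 0; 1 / 2; s3 / 6; s3 / 6; - (1 / 2)];
      [:: - (s6 / 6); s6 / 6; s6 / 6; - (s6 / 6); - (s6 / 6); s6 / 6]] in
  \matrix_(i, j) (nth [::] rows i)`_j.

Definition dftS3_poly (F : fieldType) (s2 s3 : F) : {poly F} :=
  let c1 := s3 / 3 + 1 / 2 in
  let c2 := (- (s2 / 6) + 1 / 6) * s3 - s2 / 3 - 1 / 3 in
  let c3 := (s2 / 3 + 1 / 3) * s3 + s2 / 2 in
  'X^6 - c1 *: 'X^5 + c2 *: 'X^4 + c3 *: 'X^3 + c2 *: 'X^2 - c1 *: 'X + 1.

(* Main.v *)
From Stdlib Require Import BinInt.
Require Import Defs.
From HB Require Import structures.
From mathcomp Require Import all_boot all_order all_algebra all_fingroup.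
From mathcomp Require Import all_solvable all_field.
From mathcomp Require Import reals.
From mathcomp Require Import ring ssrZ.

Set Implicit Arguments.
Unset Strict Implicit.
Unset Printing Implicit Defensive.

Import GRing.Theory Num.Theory.

Local Open Scope ring_scope.

(** The polynomial f is reciprocal, so its roots come in pairs (z, 1/z), and
    f(x) = x^3 g(x + 1/x) for a cubic g. Hence the Galois group G permutes three
    pairs and embeds in the wreath product, of order 48 (rperm_sub); the content
    of the theorem is that G is not smaller.

    Let y_0, y_1, y_2 be the roots of g and let delta_i = z_i - 1/z_i, so that
    delta_i^2 = y_i^2 - 4 =: d_i. The maximal subgroups of the wreath product are
    its three subgroups of index 2, the stabilizers of a pair (index 3), and the
    normalizers of the Sylow 3-subgroups (index 4). Accordingly G is the whole
    wreath product as soon as five polynomials have no root in the base field: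
    g itself; X^2 - disc(g), X^2 - D and X^2 - disc(g) D with D = d_0 d_1 d_2;
    and a quartic whose roots are the squares of delta_0 +- delta_1 +- delta_2.
    This criterion, card_gal_sextic, is proved by counting. The irreducibility
    of g gives a factor 3 of the order of G; the square roots of disc(g) and D
    generate a biquadratic field, whose fixing group G0 is normal of index 4, so
    the order of G0 is 3, 6 or 12. If G0 had a single Sylow 3-subgroup P, then P
    would be normal in G, the trace of delta_0 under P would be fixed by G up to
    sign, and its square would be a root of the quartic in the base field
    (no_normal_order3).
    So G0 has at least four Sylow 3-subgroups, and its order is 12.

    The five nonexistence statements over K = Q(sqrt 2, sqrt 3) are verified
    modulo primes of degree one above 23 and 47. If 2 and 3 are
    squares modulo a prime p not dividing 6, then Z[sqrt 2, sqrt 3] has no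
    nilpotents modulo p, so an element of K that is a root of a monic polynomial
    over this ring has no p in its denominator; its image modulo p is then a root
    of the image of the polynomial (root_modp). It remains to inspect the residues modulo 23 and 47.

    The characteristic polynomial is identified with f by comparing the two at
    seven integers, inside Z[sqrt 2, sqrt 3] after multiplication by 6. *)

(** * Quadratic and biquadratic extensions *)

Section Quadratic.
Variables (F : fieldType) (L : fieldExtType F).
Implicit Types (E : {subfield L}) (x y : L).

Lemma dim_adjoin_sqrt E x : x \notin E -> x ^+ 2 \in E ->
  \dim <<E; x>> = (2 * \dim E)%N.
Proof.
move=> nEx Ex2; rewrite dim_Fadjoin; congr (_ * _)%N.
have xr : root ('X^2 - (x ^+ 2)%:P) x by rewrite rootE !hornerE subrr.
have Ep : 'X^2 - (x ^+ 2)%:P \is a polyOver E.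
  by rewrite rpredB ?rpredX ?polyOverX ?polyOverC.
have := dvdp_leq _ (minPoly_dvdp Ep xr).
rewrite -size_poly_gt0 size_XnsubC // size_minPoly ltnS => /(_ isT).
have := adjoin_deg_eq1 E x; rewrite (negPf nEx).
by case: (adjoin_degree E x) (isT : (0 < adjoin_degree E x)%N) => [|[|[]]].
Qed.

Lemma adjoin_sqrtP E x y : x \notin E -> x ^+ 2 \in E -> y \in <<E; x>>%VS ->
  exists a b, [/\ a \in E, b \in E & y = a + b * x].
Proof.
move=> nEx Ex2 /Fadjoin_poly_eq <-.
have := size_Fadjoin_poly E x y; have := Fadjoin_polyOver E x y.
have -> : adjoin_degree E x = 2.
  have := dim_adjoin_sqrt nEx Ex2; rewrite dim_Fadjoin => /eqP.
  by rewrite eqn_pmul2r ?adim_gt0 // => /eqP.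
set p := Fadjoin_poly _ _ _ => /polyOverP Ep.
move=> sp; exists p`_0, p`_1; split=> //.
rewrite (horner_coef_wide _ sp) 2!big_ord_recr big_ord0 /=.
by rewrite add0r expr0 mulr1 expr1.
Qed.

Variables (u v : L) (al be : F).
Hypotheses (two : 2 != 0 :> F) (u2 : u ^+ 2 = al%:A) (v2 : v ^+ 2 = be%:A).
Hypothesis al_nsq : forall w, w ^+ 2 != al.
Hypothesis be_nsq : forall w, w ^+ 2 != be.
Hypothesis albe_nsq : forall w, w ^+ 2 != al * be.

Lemma sqrt_notin (w : L) c : w ^+ 2 = c%:A -> (forall w, w ^+ 2 != c) -> w \notin 1%VS.
Proof.
move=> w2 c_nsq; apply/negP=> /vlineP[k ek]; have /eqP[] := c_nsq k.
by apply: (fmorph_inj (in_alg L)); rewrite rmorphXn /= -ek w2.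
Qed.

Let nu : u \notin 1%VS := sqrt_notin u2 al_nsq.
Let u2_1 : u ^+ 2 \in 1%VS. Proof. by rewrite u2 rpredZ ?mem1v. Qed.

(** Squaring v = a + b u gives 2 a b u in F, so a b = 0; then al be or be is a
    square in F. *)
Lemma second_sqrt_notin : v \notin <<1; u>>%VS.
Proof.
apply/negP=> /(adjoin_sqrtP nu u2_1)[_ [_ [/vlineP[a ->] /vlineP[b ->] vE]]].
have two' : 2 != 0 :> L by rewrite -(rmorph_nat (in_alg L)) fmorph_eq0.
have := v2; rewrite vE.
have -> : (a%:A + b%:A * u) ^+ 2 = (a ^+ 2 + b ^+ 2 * al)%:A + 2 * (a * b)%:A * u.
  rewrite -!in_algE !(rmorphD, rmorphM, rmorphXn) /= -u2; ring.
move=> e.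
have ab0 : a * b = 0.
  apply/eqP; apply: contraT => ab; case/negP: nu.
  have ab' : (a * b)%:A != 0 :> L by rewrite -in_algE fmorph_eq0.
  have -> : u = (be%:A - (a ^+ 2 + b ^+ 2 * al)%:A) / (2 * (a * b)%:A).
    by rewrite -e addrAC subrr add0r mulrC mulKf // mulf_neq0.
  rewrite rpred_div ?rpredB ?rpredM ?rpredZ ?mem1v //.
  by rewrite -(rmorph_nat (in_alg L)) rpredZ ?mem1v.
move: e; rewrite ab0 scale0r mulr0 mul0r addr0 -!in_algE => /fmorph_inj e.
move/eqP: ab0; rewrite mulf_eq0 => /orP[]/eqP z; move: e; rewrite z expr0n /=.
  rewrite add0r => e; have /eqP[] := albe_nsq (b * al); rewrite -e; ring.
by rewrite mul0r addr0 => e; have /eqP[] := be_nsq a.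
Qed.

Let v2_u : v ^+ 2 \in <<1; u>>%VS.
Proof. by rewrite v2 rpredZ ?mem1v. Qed.

Lemma dim_biquadratic : \dim <<<<1; u>>; v>> = 4%N.
Proof. by rewrite !dim_adjoin_sqrt // ?second_sqrt_notin // dimv1. Qed.

Lemma biquadratic_span w : w \in <<<<1; u>>; v>>%VS ->
  exists a b c d : F, w = a%:A + b%:A * u + c%:A * v + d%:A * (u * v).
Proof.
case/(adjoin_sqrtP second_sqrt_notin v2_u) => x [y [xu yu ->]].
have [_ [_ [/vlineP[a ->] /vlineP[b ->] ->]]] := adjoin_sqrtP nu u2_1 xu.
have [_ [_ [/vlineP[c ->] /vlineP[d ->] ->]]] := adjoin_sqrtP nu u2_1 yu.
by exists a, b, c, d; ring.
Qed.

Lemma adjoin_sqrt_free E x a b : x \notin E -> a \in E -> b \in E -> a + b * x = 0 ->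
  a = 0 /\ b = 0.
Proof.
move=> nEx aE bE e; have b0 : b = 0.
  apply/eqP; apply: contraT => nb; case/negP: nEx.
  have -> : x = - a / b.
    by apply: (mulIf nb); rewrite divfK //; apply/eqP; rewrite -addr_eq0 addrC mulrC e.
  by rewrite rpred_div ?rpredN.
by move: e; rewrite b0 mul0r addr0.
Qed.

Lemma biquadratic_free (a b c d : F) :
  a%:A + b%:A * u + c%:A * v + d%:A * (u * v) = 0 -> [/\ a = 0, b = 0, c = 0 & d = 0].
Proof.
have E1 k : k%:A \in (1%VS : {vspace L}) by rewrite rpredZ ?mem1v.
have Eu k : k%:A \in <<1; u>>%VS by rewrite rpredZ ?mem1v.
have uu : u \in <<1; u>>%VS by rewrite memv_adjoin.
move=> e.
have [|||] := @adjoin_sqrt_free _ v (a%:A + b%:A * u) (c%:A + d%:A * u)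
  second_sqrt_notin.
- by rewrite rpredD ?rpredM.
- by rewrite rpredD ?rpredM.
- by rewrite -e; ring.
have inj (k : F) : k%:A = 0 :> L -> k = 0 by move/eqP; rewrite -in_algE fmorph_eq0 => /eqP.
move=> /(adjoin_sqrt_free nu (E1 _) (E1 _))[/inj-> /inj->].
by move=> /(adjoin_sqrt_free nu (E1 _) (E1 _))[/inj-> /inj->].
Qed.
End Quadratic.

(** * Reciprocal sextics *)

Definition rsextic (T : comNzRingType) (a b c : T) : {poly T} :=
  'X^6 + a *: 'X^5 + b *: 'X^4 + c *: 'X^3 + b *: 'X^2 + a *: 'X + 1.

(** The pair of roots z, 1/z is governed by the single number z + 1/z. *)
Lemma quad_inverse_roots (L : fieldType) (z : L) : z != 0 ->
  'X^2 - (z + z^-1) *: 'X + 1 = ('X - z%:P) * ('X - (z^-1)%:P).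
Proof.
move=> nz; have e : (1 : {poly L}) = z%:P * (z^-1)%:P by rewrite -polyCM divff.
rewrite {1}e -!mul_polyC !(polyCN, polyCD); ring.
Qed.

Lemma quad_root (L : fieldType) (y z : L) : root ('X^2 - y *: 'X + 1) z ->
  z != 0 /\ y = z + z^-1.
Proof.
rewrite rootE !hornerE /= => /eqP e.
have nz : z != 0 by apply/eqP => z0; have /eqP[] := oner_neq0 L; rewrite -[RHS]e z0; ring.
split=> //; apply: (mulIf nz); rewrite mulrDl mulVf // -expr2.
by apply/eqP; rewrite eq_sym -subr_eq0 -e; apply/eqP; ring.
Qed.

Lemma dvdp_split_root (L : fieldType) (rs : seq L) (p : {poly L}) :
  (1 < size p)%N -> p %| \prod_(z <- rs) ('X - z%:P) -> exists z, root p z.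
Proof.
move=> sp /dvdp_prod_XsubC[m e].
have : size (\prod_(z <- mask m rs) ('X - z%:P)) = size p by apply/esym/eqp_size.
rewrite size_prod_XsubC => es; case: (mask m rs) e es => [|z s e _] /=.
  by move=> _ es; rewrite -es in sp.
by exists z; rewrite (eqp_root e) root_prod_XsubC mem_head.
Qed.

Lemma size_rsextic (L : fieldType) (a b c : L) : size (rsextic a b c) = 7%N.
Proof.
have -> : rsextic a b c = Poly [:: 1; a; b; c; b; a; 1].
  apply/polyP=> i; rewrite coef_Poly /rsextic !coefE.
  by do 7?[case: i => [|i] /=]; rewrite ?nth_nil ?(mulr0, mulr1, addr0, add0r).
by rewrite (PolyK (c := 1)) //= oner_eq0.
Qed.
Lemma size_rquartic (L : fieldType) (p q : L) :
  size ('X^4 + p *: 'X^3 + q *: 'X^2 + p *: 'X + 1) = 5%N.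
Proof.
have -> : 'X^4 + p *: 'X^3 + q *: 'X^2 + p *: 'X + 1 = Poly [:: 1; p; q; p; 1].
  apply/polyP=> i; rewrite coef_Poly !coefE.
  by do 5?[case: i => [|i] /=]; rewrite ?nth_nil ?(mulr0, mulr1, addr0, add0r).
by rewrite (PolyK (c := 1)) //= oner_eq0.
Qed.
Lemma size_rquad (L : fieldType) (y : L) : size ('X^2 - y *: 'X + 1) = 3%N.
Proof.
have -> : 'X^2 - y *: 'X + 1 = Poly [:: 1; - y; 1].
  apply/polyP=> i; rewrite coef_Poly !coefE.
  by do 3?[case: i => [|i] /=]; rewrite ?nth_nil ?(mulr0, mulr1, addr0, add0r, oppr0).
by rewrite (PolyK (c := 1)) //= oner_eq0.
Qed.

(** Peeling off one factor X^2 - (x + 1/x) X + 1 leaves a reciprocal quartic, and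
    peeling off a second one leaves a reciprocal quadratic. The last clause
    is the expansion of f(x) = x^3 g(x + 1/x) for the monic cubic g with roots X, Y, Z. *)
Lemma rsextic_split (L : fieldType) (a b c : L) rs :
    rsextic a b c %| \prod_(z <- rs) ('X - z%:P) ->
  exists x y z, [/\ x != 0, y != 0, z != 0,
    rsextic a b c = ('X - x%:P) * ('X - (x^-1)%:P) * (('X - y%:P) * ('X - (y^-1)%:P)) *
      (('X - z%:P) * ('X - (z^-1)%:P)) &
    let X := x + x^-1 in let Y := y + y^-1 in let Z := z + z^-1 in
    [/\ a = - (X + Y + Z), b = 3 + X * Y + X * Z + Y * Z &
    c = - (X * Y * Z + 2 * (X + Y + Z))]].
Proof.
move=> dv.
have [|x] := dvdp_split_root _ dv; first by rewrite size_rsextic.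
rewrite rootE !hornerE /= => /eqP xr.
have nx : x != 0.
  by apply/eqP => x0; have /eqP[] := oner_neq0 L; rewrite -[RHS]xr x0; ring.
set X := x + x^-1; pose p := a + X; pose q := b - 1 + X * p.
(* The middle coefficient encodes that X is a root of the cubic g. *)
have cE : c = 2 * p - X * q.
  apply: (mulIf (expf_neq0 3 nx)); apply/eqP; rewrite -subr_eq0 -xr /q /p /X.
  by apply/eqP; field.
have fE : rsextic a b c = ('X^2 - X *: 'X + 1) *
    ('X^4 + p *: 'X^3 + q *: 'X^2 + p *: 'X + 1).
  rewrite (_ : a = p - X); last by rewrite /p; ring.
  rewrite (_ : b = q + 1 - X * p); last by rewrite /q; ring.
  rewrite cE /rsextic -!mul_polyC !(polyCN, polyCD, polyCM, polyC1) ?polyC_natr.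
  ring.
move: (dv); rewrite fE => /(dvdp_trans (dvdp_mull _ (dvdpp _))) dv4.
have [|y] := dvdp_split_root _ dv4; first by rewrite size_rquartic.
rewrite rootE !hornerE /= => /eqP yr.
have ny : y != 0.
  by apply/eqP => y0; have /eqP[] := oner_neq0 L; rewrite -[RHS]yr y0; ring.
set Y := y + y^-1; pose Z := - p - Y.
have qE : q = 2 + Y * Z.
  apply: (mulIf (expf_neq0 2 ny)); apply/eqP; rewrite -subr_eq0 -yr /Z /Y.
  by apply/eqP; field.
have f4E : 'X^4 + p *: 'X^3 + q *: 'X^2 + p *: 'X + 1 =
    ('X^2 - Y *: 'X + 1) * ('X^2 - Z *: 'X + 1).
  rewrite qE (_ : p = - (Y + Z)); last by rewrite /Z; ring.
  rewrite -!mul_polyC !(polyCN, polyCD, polyCM, polyC1) ?polyC_natr.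
  ring.
move: dv4; rewrite f4E => /(dvdp_trans (dvdp_mull _ (dvdpp _))) dv2.
have [|z /quad_root[nz ZE]] := dvdp_split_root _ dv2; first by rewrite size_rquad.
exists x, y, z; split=> //.
  by rewrite -!quad_inverse_roots // -/X -/Y -ZE mulrA.
rewrite -/X -/Y -ZE; split.
- by rewrite /Z /p; ring.
- have -> : b = q + 1 - X * p by rewrite /q; ring.
  by rewrite qE /Z; ring.
- by rewrite cE qE /Z; ring.
Qed.

(** * The cubic of a reciprocal sextic and its invariants *)

Section Invariants.
Variable T : comNzRingType.
Implicit Types (k A B C x y z : T).
Definition cubic A B C y := y ^+ 3 + A * y ^+ 2 + B * y + C.
Definition cdisc A B C :=
  A ^+ 2 * B ^+ 2 - 4 * B ^+ 3 - 4 * A ^+ 3 * C - 27 * C ^+ 2 + 18 * A * B * C.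
(** With y_i the roots of the cubic and d_i = y_i^2 - 4 k^2, the next three are
    the elementary symmetric functions of d_0, d_1, d_2. The sextic itself has
    k = 1; the value k = 6 serves the cubic with roots 6 y_i, which has integral
    coefficients in the application. *)
Definition dsum k A B := A ^+ 2 - 2 * B - 12 * k ^+ 2.
Definition dsum2 k A B C :=
  B ^+ 2 - 2 * A * C - 8 * k ^+ 2 * (A ^+ 2 - 2 * B) + 48 * k ^+ 4.
Definition dprod k A B C := cubic A B C (2 * k) * cubic A B C (- (2 * k)).
(** The quartic with roots (delta_0 +- delta_1 +- delta_2)^2, where
    delta_i^2 = d_i. For any choice of the signs of the delta_i, their sum s satisfies
    s^2 - sum d_i = 2 (delta_0 delta_1 + delta_0 delta_2 + delta_1 delta_2), and
    squaring once more leaves 8 delta_0 delta_1 delta_2 s, whose square is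
    64 d_0 d_1 d_2 s^2. *)
Definition sresolvent k A B C x :=
  ((x - dsum k A B) ^+ 2 - 4 * dsum2 k A B C) ^+ 2 - 64 * dprod k A B C * x.

Definition vieta3 A B C x y z :=
  [/\ A = - (x + y + z), B = x * y + x * z + y * z & C = - (x * y * z)].

Lemma cdiscE A B C x y z : vieta3 A B C x y z ->
  cdisc A B C = ((x - y) * (x - z) * (y - z)) ^+ 2.
Proof. by case=> -> -> ->; rewrite /cdisc; ring. Qed.

Lemma dprodE A B C x y z : vieta3 A B C x y z ->
  dprod 1 A B C = (x ^+ 2 - 4) * (y ^+ 2 - 4) * (z ^+ 2 - 4).
Proof. by case=> -> -> ->; rewrite /dprod /cubic; ring. Qed.

Lemma sresolventE A B C x y z a b c : vieta3 A B C x y z ->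
    a ^+ 2 = x ^+ 2 - 4 -> b ^+ 2 = y ^+ 2 - 4 -> c ^+ 2 = z ^+ 2 - 4 ->
  sresolvent 1 A B C ((a + b + c) ^+ 2) = 0.
Proof.
move=> V a2 b2 c2; rewrite /sresolvent (dprodE V) -a2 -b2 -c2.
have -> : dsum 1 A B = a ^+ 2 + b ^+ 2 + c ^+ 2.
  by rewrite a2 b2 c2; case: V => -> -> _; rewrite /dsum; ring.
have -> : dsum2 1 A B C =
    a ^+ 2 * b ^+ 2 + a ^+ 2 * c ^+ 2 + b ^+ 2 * c ^+ 2.
  by rewrite a2 b2 c2; case: V => -> -> ->; rewrite /dsum2; ring.
ring.
Qed.

Lemma cubicE A B C x y z w : vieta3 A B C x y z ->
  cubic A B C w = (w - x) * (w - y) * (w - z).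
Proof. by case=> -> -> ->; rewrite /cubic; ring. Qed.
End Invariants.

(** Divided differences of the cubic at x, y, z determine A, then B, then C. *)
Lemma vieta3P (T : idomainType) (A B C x y z : T) : x != y -> x != z -> y != z ->
  cubic A B C x = 0 -> cubic A B C y = 0 -> cubic A B C z = 0 -> vieta3 A B C x y z.
Proof.
move=> nxy nxz nyz ex ey ez.
have e1 : (x + y) * A + (x ^+ 2 + x * y + y ^+ 2) + B = 0.
  apply: (mulfI (_ : x - y != 0)); rewrite ?subr_eq0 // mulr0.
  by transitivity (cubic A B C x - cubic A B C y); [rewrite /cubic; ring | rewrite ex ey subrr].
have e2 : (x + z) * A + (x ^+ 2 + x * z + z ^+ 2) + B = 0.
  apply: (mulfI (_ : x - z != 0)); rewrite ?subr_eq0 // mulr0.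
  by transitivity (cubic A B C x - cubic A B C z); [rewrite /cubic; ring | rewrite ex ez subrr].
have eA : A + (x + y + z) = 0.
  apply: (mulfI (_ : y - z != 0)); rewrite ?subr_eq0 // mulr0.
  rewrite -(subrr (0 : T)) -{1}e1 -e2; ring.
have AE : A = - (x + y + z) by apply/eqP; rewrite -addr_eq0 eA.
have BE : B = x * y + x * z + y * z.
  apply/eqP; rewrite -subr_eq0 -e1 AE; apply/eqP; ring.
split=> //; apply/eqP; rewrite -subr_eq0 -ex /cubic AE BE; apply/eqP; ring.
Qed.

Section InvariantsMorph.
Variables (S T : comNzRingType) (f : {rmorphism S -> T}).
Lemma rmorph_cubic A B C y : f (cubic A B C y) = cubic (f A) (f B) (f C) (f y).
Proof. by rewrite /cubic; ring. Qed.
Lemma rmorph_cdisc A B C : f (cdisc A B C) = cdisc (f A) (f B) (f C).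
Proof. by rewrite /cdisc; ring. Qed.
Lemma rmorph_dprod k A B C : f (dprod k A B C) = dprod (f k) (f A) (f B) (f C).
Proof. by rewrite /dprod /cubic; ring. Qed.
Lemma rmorph_sresolvent k A B C x :
  f (sresolvent k A B C x) = sresolvent (f k) (f A) (f B) (f C) (f x).
Proof. by rewrite /sresolvent /dsum /dsum2 /dprod /cubic; ring. Qed.
Lemma map_rsextic a b c : map_poly f (rsextic a b c) = rsextic (f a) (f b) (f c).
Proof.
by rewrite /rsextic !(rmorphD, rmorph1) /= !(map_polyZ, map_polyXn, map_polyX).
Qed.
End InvariantsMorph.

Section CubicField.
Variables (F : fieldType) (L : fieldExtType F) (A B C : F).
Local Notation cubicL := (cubic A%:A B%:A C%:A : L -> L).
Hypothesis no_root : forall y : F, cubic A B C y != 0.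

Definition cubicp : {poly F} := 'X^3 + A *: 'X^2 + B *: 'X + C%:P.

Lemma size_cubicp : size cubicp = 4%N.
Proof.
have -> : cubicp = Poly [:: C; B; A; 1].
  apply/polyP=> i; rewrite coef_Poly !coefE.
  by do 4?[case: i => [|i] /=]; rewrite ?nth_nil ?(mulr0, mulr1, addr0, add0r).
by rewrite (PolyK (c := 1)) //= oner_eq0.
Qed.

Lemma horner_cubicp (y : L) : (map_poly (in_alg L) cubicp).[y] = cubicL y.
Proof.
rewrite /cubicp !rmorphD /= !map_polyZ map_polyC !map_polyXn map_polyX.
by rewrite !hornerE /= /cubic; ring.
Qed.

Lemma cubicp_irr : irreducible_poly cubicp.
Proof.
apply: cubic_irreducible; first by rewrite size_cubicp.
move=> y; have := no_root y; congr (_ != 0).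
by rewrite /cubicp !hornerE /= /cubic; ring.
Qed.

(** A cubic without roots is irreducible. *)
Lemma minPoly_cubic y : cubicL y = 0 -> minPoly 1 y %= map_poly (in_alg L) cubicp.
Proof.
move=> ry.
have /polyOver1P[m em] := minPolyOver 1 y.
have : minPoly 1 y %| map_poly (in_alg L) cubicp.
  by apply: minPoly_dvdp; [exact: alg_polyOver | rewrite rootE horner_cubicp ry].
rewrite em dvdp_map eqp_map => dv; apply: cubicp_irr.2 dv.
have := size_minPoly 1 y; rewrite em size_map_poly => ->.
by [].
Qed.

Lemma dim_cubic y : cubicL y = 0 -> \dim <<1; y>> = 3%N.
Proof.
move=> ry; rewrite dim_Fadjoin dimv1 muln1.
have := eqp_size (minPoly_cubic ry).
by rewrite size_minPoly size_map_poly size_cubicp => /eq_add_S.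
Qed.
End CubicField.

(** * The Galois action on three pairs of inverse roots *)

Local Notation point := ('I_3 * 'I_2)%type.

(** The involution that exchanges the two points of every pair; on the roots it
    is inversion. *)
Definition flip (p : point) : point := (p.1, rev_ord p.2).

Lemma ord2P (j : 'I_2) : j = ord0 \/ j = rev_ord ord0.
Proof. by case: j => [[|[|]] // h]; [left|right]; apply: val_inj. Qed.

(** The wreath product is the centralizer of flip in the symmetric group on the six
    points: a permutation commuting with flip preserves the set of pairs. *)
Lemma S2wrS3_flip (s : {perm point}) :
  (forall p, s (flip p) = flip (s p)) -> s \in S2wrS3.
Proof.
move=> sf; have s1 i j : (s (i, j)).1 = (s (i, ord0)).1.
  by case: (ord2P j) => -> //; rewrite -[(i, _)]/(flip (i, ord0)) sf.
rewrite S2wrS3_stabilizer 3!inE /=; apply/subsetP=> _ /imsetP[i _ ->].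
rewrite inE /=; apply/imsetP; exists (s (i, ord0)).1 => //.
apply/eqP; rewrite eqEcard; apply/andP; split; last first.
  rewrite card_imset; last by move=> j j' [].
  rewrite /setact card_imset; last by move=> a b; apply: perm_inj.
  by rewrite card_imset // => j j' [].
apply/subsetP=> _ /imsetP[_ /imsetP[j _ ->] ->]; apply/imsetP.
by exists (s (i, j)).2; rewrite //= apermE -(s1 i j) -surjective_pairing.
Qed.

Section RootPerm.
Variables (F : fieldType) (L : splittingFieldType F) (f : {poly F}).
Variable r : point -> L.
Hypothesis r_inj : injective r.
Hypothesis fE : map_poly (in_alg L) f = \prod_p ('X - (r p)%:P).
Hypothesis r_gen : <<1 & codom r>>%VS = {:L}%VS.
Hypothesis r_flip : forall p, r (flip p) = (r p)^-1.
Local Notation G := ('Gal({:L} / 1))%g.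

Let root_codom a : root (map_poly (in_alg L) f) a = (a \in codom r).
Proof.
rewrite fE rootE horner_prod; apply/prodf_eq0/codomP => [[p _]|[p ->]].
  by rewrite hornerXsubC subr_eq0 => /eqP ->; exists p.
by exists p; rewrite // hornerXsubC subrr.
Qed.

Lemma in_gal1 (x : gal_of {:L}) : x \in G.
Proof. by rewrite gal_kHom ?sub1v // k1AHom. Qed.

Lemma gal_alg (x : gal_of {:L}) (k : F) : x k%:A = k%:A.
Proof. by rewrite linearZ /= rmorph1. Qed.

Let gal_root (x : gal_of {:L}) p : exists q, r q == x (r p).
Proof.
have : x (r p) \in codom r.
  rewrite -root_codom; have : root (map_poly (in_alg L) f) (r p) by rewrite root_codom codom_f.
  rewrite -(fmorph_root x) -map_poly_comp.
  by rewrite (@eq_map_poly _ _ _ (in_alg L)) // => k /=; rewrite gal_alg.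
by case/codomP=> q ->; exists q.
Qed.

Definition rperm_fun (x : gal_of {:L}) p := xchoose (gal_root x p).

Lemma rperm_funE (x : gal_of {:L}) p : r (rperm_fun x p) = x (r p).
Proof. by apply/eqP/(xchooseP (gal_root x p)). Qed.

Fact rperm_fun_inj x : injective (rperm_fun x).
Proof.
by move=> p q /(congr1 r); rewrite !rperm_funE => /fmorph_inj/r_inj.
Qed.

(** By injectivity of r, an automorphism x permutes the labels of the roots. *)
Definition rperm x : {perm point} := perm (@rperm_fun_inj x).

Lemma rpermE (x : gal_of {:L}) p : x (r p) = r (rperm x p).
Proof. by rewrite permE rperm_funE. Qed.

Lemma rpermM : {in G &, {morph rperm : x y / (x * y)%g}}.
Proof.
move=> x y _ _; apply/permP=> p; apply: r_inj.
by rewrite -rpermE permM -!rpermE galM ?memvf.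
Qed.
Canonical rperm_morphism := Morphism rpermM.

Lemma gal_fix_gen (x : gal_of {:L}) : (forall p, x (r p) = r p) -> x = 1%g.
Proof.
move=> xr; apply/eqP/gal_eqP => a _; rewrite gal_id.
suff : a \in fixedField [set x] by case/mem_fixedFieldP => _ /(_ x (set11 x)).
have : a \in <<1 & codom r>>%VS by rewrite r_gen memvf.
apply: subvP; apply/Fadjoin_seqP; split; first exact: sub1v.
move=> _ /codomP[p ->]; apply/fixedFieldP; first exact: memvf.
by move=> _ /set1P->.
Qed.

Lemma rperm_injm : ('injm rperm)%g.
Proof.
apply/subsetP=> x /(kerP _ (in_gal1 x)) e; rewrite inE; apply/eqP/gal_fix_gen => p.
by rewrite rpermE e perm1.
Qed.

(** Automorphisms commute with inversion. *)
Lemma rperm_sub : (rperm @* G \subset S2wrS3)%g.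
Proof.
apply/subsetP=> _ /morphimP[x _ _ ->]; apply: S2wrS3_flip => p.
by apply: r_inj; rewrite r_flip -!rpermE r_flip fmorphV.
Qed.

Lemma card_gal_dvd : (#|G| %| 48)%N.
Proof.
rewrite -card_S2wrS3 -(card_injm rperm_injm (subxx _)).
exact: cardSg rperm_sub.
Qed.

Lemma rperm_isom : #|G| = 48%N -> isom G S2wrS3 rperm.
Proof.
move=> cG; apply/isomP; split; first exact: rperm_injm.
by apply/eqP; rewrite eqEcard rperm_sub card_S2wrS3 card_injm ?rperm_injm // cG.
Qed.
End RootPerm.

Local Notation i0 := (ord0 : 'I_3).
Local Notation i1 := (@Ordinal 3 1 isT).
Local Notation i2 := (@Ordinal 3 2 isT).
Local Notation j0 := (ord0 : 'I_2).
Local Notation j1 := (@Ordinal 2 1 isT).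

Lemma ord3P (i : 'I_3) : [\/ i = i0, i = i1 | i = i2].
Proof.
case: i => [[|[|[|]]] // h]; [constructor 1|constructor 2|constructor 3];
  exact: val_inj.
Qed.

(** For the labelling r of the roots, these are y_i = z_i + 1/z_i and
    delta_i = z_i - 1/z_i. *)
Definition ytrace (T : zmodType) (r : point -> T) i := r (i, j0) + r (i, j1).
Definition ydelta (T : zmodType) (r : point -> T) i := r (i, j0) - r (i, j1).

Section SexticRoots.
Variables (F : fieldType) (L : fieldExtType F) (A B C : F).
Local Notation f := (rsextic A (B + 3) (C + 2 * A)).

(** The coefficients of f are those for which the numbers z + 1/z are the roots of
    X^3 + A X^2 + B X + C. *)
Lemma sextic_roots :
  splittingFieldFor 1 (map_poly (in_alg L) f) {:L} ->
  exists r : point -> L, [/\ forall p, r p * r (flip p) = 1,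
    map_poly (in_alg L) f = \prod_p ('X - (r p)%:P),
    <<1 & codom r>>%VS = {:L}%VS &
    vieta3 A%:A B%:A C%:A (ytrace r i0) (ytrace r i1) (ytrace r i2)].
Proof.
case=> rs frs rs_gen.
have [x [y [z [nx ny nz]]]] : exists x y z : L, [/\ x != 0, y != 0, z != 0,
    map_poly (in_alg L) f = ('X - x%:P) * ('X - (x^-1)%:P) * (('X - y%:P) * ('X - (y^-1)%:P)) *
      (('X - z%:P) * ('X - (z^-1)%:P)) &
    vieta3 A%:A B%:A C%:A (x + x^-1) (y + y^-1) (z + z^-1)].
  move: frs; rewrite map_rsextic => frs.
  have dv : rsextic (in_alg L A) (in_alg L (B + 3)) (in_alg L (C + 2 * A)) %|
     \prod_(z <- rs) ('X - z%:P) by rewrite (eqp_dvdl _ frs).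
  have [x [y [z [nx ny nz e /= [eA eB eC]]]]] := rsextic_split dv.
  exists x, y, z; split=> //; split; first exact: eA.
    have -> : B%:A = (B + 3)%:A - 3 :> L by rewrite scalerDl scaler_nat addrK.
    by rewrite eB; ring.
  have -> : C%:A = (C + 2 * A)%:A - 2 * A%:A :> L.
    by rewrite scalerDl -scalerA scaler_nat mulr_natl addrK.
  by rewrite eC eA; ring.
move=> fE V.
pose zs (i : 'I_3) := nth 0 [:: x; y; z] i.
pose r (p : point) := if p.2 == j0 then zs p.1 else (zs p.1)^-1.
have fE' : map_poly (in_alg L) f = \prod_p ('X - (r p)%:P).
  transitivity (\prod_i \prod_j ('X - (r (i, j))%:P)); last first.
    by rewrite pair_bigA /=; apply: eq_bigr => -[].
  by rewrite fE !big_ord_recl !big_ord0 !mulr1 /r /= !mulrA.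
exists r; split=> //.
- move=> [i j]; have nzs : zs i != 0 by case: (ord3P i) => ->.
  by case: (ord2P j) => -> /=; rewrite /r /= ?rev_ordK /= ?divff ?mulVf.
- have rrs : codom r =i rs.
    move=> a; rewrite -[a \in rs]root_prod_XsubC -(eqp_root frs) fE' rootE horner_prod.
    apply/codomP/prodf_eq0 => [[p ->]|[p _]].
      by exists p; rewrite // hornerXsubC subrr.
    by rewrite hornerXsubC subr_eq0 => /eqP ->; exists p.
  by rewrite -rs_gen; apply/eqP; rewrite eqEsubv !adjoin_seqSr // => a; rewrite rrs.
Qed.
End SexticRoots.

(** * Reciprocal sextics with the full wreath product as Galois group *)

Section SexticGalois.
Variables (F : fieldType) (L : splittingFieldType F) (A B C : F).
Variable r : point -> L.
Local Notation f := (rsextic A (B + 3) (C + 2 * A)).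
Local Notation y := (ytrace r).
Local Notation delta := (ydelta r).
Local Notation G := ('Gal({:L} / 1))%g.
Hypothesis r_mul : forall p, r p * r (flip p) = 1.
Hypothesis fE : map_poly (in_alg L) f = \prod_p ('X - (r p)%:P).
Hypothesis r_gen : <<1 & codom r>>%VS = {:L}%VS.
Hypothesis V : vieta3 A%:A B%:A C%:A (y i0) (y i1) (y i2).
Hypothesis two : 2 != 0 :> F.
Hypothesis no_root : forall w : F, cubic A B C w != 0.
Hypothesis disc_nsq : forall w : F, w ^+ 2 != cdisc A B C.
Hypothesis dprod_nsq : forall w : F, w ^+ 2 != dprod 1 A B C.
Hypothesis discdprod_nsq :
  forall w : F, w ^+ 2 != cdisc A B C * dprod 1 A B C.
Hypothesis res_no_root : forall w : F, sresolvent 1 A B C w != 0.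

Lemma r_flip p : r (flip p) = (r p)^-1.
Proof.
have nr : r p != 0.
  by apply/eqP => r0; have /eqP := r_mul p; rewrite r0 mul0r eq_sym oner_eq0.
by apply: (mulfI nr); rewrite r_mul divff.
Qed.

Lemma flip0 i : flip (i, j0) = (i, j1).
Proof. by congr (_, _); apply: val_inj. Qed.

Lemma flip1 i : flip (i, j1) = (i, j0).
Proof. by congr (_, _); apply: val_inj. Qed.

(** The sum z + 1/z does not see which root of the pair is z. *)
Lemma ytraceE p : y p.1 = r p + r (flip p).
Proof.
case: p => i j; case: (ord2P j) => ->; first by rewrite flip0.
by rewrite (_ : rev_ord _ = j1) ?flip1; [rewrite addrC | apply: val_inj].
Qed.

Lemma delta_sqr i : delta i ^+ 2 = y i ^+ 2 - 4.
Proof.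
have := r_mul (i, j0); rewrite flip0 /ydelta /ytrace => e.
have -> : 4 = 4 * (r (i, j0) * r (i, j1)) by rewrite e mulr1.
ring.
Qed.

Let u := (y i0 - y i1) * (y i0 - y i2) * (y i1 - y i2).
Let v := delta i0 * delta i1 * delta i2.

Lemma sqrt_disc_sqr : u ^+ 2 = (cdisc A B C)%:A.
Proof. by rewrite -(cdiscE V); apply/esym/(rmorph_cdisc (in_alg L)). Qed.

Lemma sqrt_dprod_sqr : v ^+ 2 = (dprod 1 A B C)%:A.
Proof.
rewrite /v !exprMn !delta_sqr -(dprodE V).
by have := rmorph_dprod (in_alg L) 1 A B C; rewrite rmorph1.
Qed.

Lemma nsq_neq0 (w : L) c : w ^+ 2 = c%:A -> (forall w : F, w ^+ 2 != c) -> w != 0.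
Proof.
move=> e nsq; have nc : c != 0 by have := nsq 0; rewrite expr0n eq_sym.
by apply: contraNneq nc => w0; rewrite -(fmorph_eq0 (in_alg L)) /= -e w0 expr0n.
Qed.

Lemma y_inj : injective y.
Proof.
have := nsq_neq0 sqrt_disc_sqr disc_nsq; rewrite /u !mulf_eq0 !subr_eq0 !negb_or.
move=> /andP[/andP[/eqP n1 /eqP n2] /eqP n3] i j.
by case: (ord3P i) => ->; case: (ord3P j) => -> // e;
  first [by case: n1 | by case: n2 | by case: n3].
Qed.

Lemma delta_neq0 i : delta i != 0.
Proof.
have := nsq_neq0 sqrt_dprod_sqr dprod_nsq; rewrite /v !mulf_eq0 !negb_or.
by move=> /andP[/andP[n1 n2] n3]; case: (ord3P i) => ->.
Qed.

(** The y_i are distinct because disc(g) is not 0, and z_i differs from 1/z_i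
    because D is not 0; both are nonsquares. *)
Lemma r_inj : injective r.
Proof.
move=> [i j] [i' j'] e.
have ei : i = i'.
  by apply: y_inj; rewrite (ytraceE (i, j)) (ytraceE (i', j')) !r_flip e.
rewrite -ei in e *; congr (_, _); apply/eqP; apply: contraT => nj.
have /negP[] := delta_neq0 i; rewrite subr_eq0; apply/eqP.
have rj : rev_ord j0 = j1 by apply: val_inj.
by case: (ord2P j) e nj => ->; case: (ord2P j') => ->; rewrite ?eqxx // rj.
Qed.

Lemma prod_codom : \prod_p ('X - (r p)%:P) = \prod_(a <- codom r) ('X - a%:P).
Proof. by rewrite big_map big_enum. Qed.

Lemma galois_1L : galois 1 {:L}.
Proof.
apply/splitting_galoisField; exists (map_poly (in_alg L) f); split.
- exact: alg_polyOver.
- by rewrite fE prod_codom separable_prod_XsubC; apply/injectiveP/r_inj.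
- by exists (codom r) => //; rewrite fE prod_codom eqpxx.
Qed.

Lemma card_gal : #|G| = \dim {:L}.
Proof. by rewrite -(galois_dim galois_1L) dimv1 divn1. Qed.

Lemma cubic_y i : cubic A%:A B%:A C%:A (y i) = 0.
Proof.
by rewrite (cubicE _ V); case: (ord3P i) => ->; rewrite subrr ?(mul0r, mulr0).
Qed.

Lemma gal_transitive i : exists2 x : gal_of {:L}, x \in G & x (y i0) = y i.
Proof.
have [_ _ nL] := and3P galois_1L.
apply: normalField_root_minPoly; rewrite ?sub1v ?memvf //.
have e := minPoly_cubic no_root (cubic_y i0).
by rewrite (eqp_root e) rootE horner_cubicp cubic_y.
Qed.

Lemma dvd3_gal : (3 %| #|G|)%N.
Proof.
by rewrite card_gal -(dim_cubic no_root (cubic_y i0)) field_dimS ?subvf.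
Qed.

(** The subfield generated by the square roots u of disc(g) and v of D. *)
Definition biquad_field := <<<<1; u>>; v>>%AS.

Lemma dim_biquad_field : \dim biquad_field = 4%N.
Proof.
exact: dim_biquadratic two sqrt_disc_sqr sqrt_dprod_sqr
  disc_nsq dprod_nsq discdprod_nsq.
Qed.

(** It is the splitting field of (X^2 - disc(g)) (X^2 - D). *)
Lemma biquad_field_normal : normalField 1 biquad_field.
Proof.
apply/splitting_normalField; first exact: sub1v.
exists (map_poly (in_alg L) (('X^2 - (cdisc A B C)%:P) * ('X^2 - (dprod 1 A B C)%:P))).
  exact: alg_polyOver.
exists [:: u; - u; v; - v].
  rewrite rmorphM !rmorphB /= !map_polyC !map_polyXn /=.
  rewrite -sqrt_disc_sqr -sqrt_dprod_sqr !big_cons big_nil mulr1.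
  rewrite (_ : _ * _ = ('X - u%:P) * (('X - (- u)%:P) *
     (('X - v%:P) * ('X - (- v)%:P)))) ?eqpxx //.
  by rewrite !polyCN !polyC_exp; ring.
rewrite !adjoin_cons Fadjoin_nil.
have uu : - u \in <<1; u>>%VS by rewrite rpredN memv_adjoin.
have vv : - v \in <<<<1; u>>; v>>%VS by rewrite rpredN memv_adjoin.
rewrite (Fadjoin_idP uu); exact: (Fadjoin_idP vv).
Qed.

Local Notation G0 := ('Gal({:L} / biquad_field))%g.

Lemma card_gal0 : #|G| = (#|G0| * 4)%N.
Proof.
rewrite card_gal -(galois_dim (galoisS _ galois_1L)) ?sub1v ?subvf //.
by rewrite -dim_biquad_field -dim_sup_field ?subvf.
Qed.

Lemma gal0_normal : (G0 <| G)%g.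
Proof.
by apply: (normalField_normal _ biquad_field_normal); rewrite sub1v subvf.
Qed.

Lemma gal_cubic (x : gal_of {:L}) w :
  cubic A%:A B%:A C%:A w = 0 -> cubic A%:A B%:A C%:A (x w) = 0.
Proof.
move=> e; rewrite -(gal_alg x A) -(gal_alg x B) -(gal_alg x C).
by rewrite -rmorph_cubic e rmorph0.
Qed.

Lemma twoL : 2 != 0 :> L.
Proof. by rewrite -(rmorph_nat (in_alg L)) fmorph_eq0. Qed.

Section NormalThree.
Variable P : {group gal_of {:L}}.
Hypotheses (nP : (P <| G)%g) (cP : #|P| = 3%N).

Lemma order3_cube x (a : L) : x \in P -> x (x (x a)) = a.
Proof.
move=> Px; have := expg_cardG Px; rewrite cP !expgS expg0 mulg1 => x3.
by rewrite -[RHS](gal_id {:L}) -x3 !galM ?memvf.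
Qed.

(** Otherwise P, being normal, fixes all conjugates y_i of y_0. An element of order 3
    that fixes delta_i^2 also fixes delta_i, since it cannot change its sign. So P
    would fix the generators z_i = (y_i + delta_i) / 2 of L. *)
Lemma order3_moves : exists2 x, x \in P & x (y i0) != y i0.
Proof.
apply/exists_inP; apply: contraT; rewrite negb_exists_in => /forall_inP P_fix.
have y_fix i x : x \in P -> x (y i) = y i.
  move=> Px; have [z Gz <-] := gal_transitive i.
  rewrite -galM ?memvf // conjgCV galM ?memvf //; congr (z _); apply/eqP.
  have := P_fix (x ^ z^-1)%g; rewrite negbK; apply.
  by rewrite memJ_norm ?groupV // (subsetP (normal_norm nP)).
have d_fix i x : x \in P -> x (delta i) = delta i.
  move=> Px; have : (x (delta i)) ^+ 2 == delta i ^+ 2.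
    by rewrite -rmorphXn /= delta_sqr rmorphB rmorphXn rmorph_nat /= y_fix.
  rewrite eqf_sqr => /orP[/eqP//|/eqP e].
  have e2 : x (x (delta i)) = delta i by rewrite e rmorphN /= e opprK.
  have := order3_cube (delta i) Px; rewrite e2 e => /eqP.
  rewrite eq_sym -addr_eq0 -mulr2n -mulr_natl mulf_eq0 (negPf twoL).
  by rewrite (negPf (delta_neq0 i)).
suff P1 : P \subset [1]%g by have := subset_leq_card P1; rewrite cards1 cP.
apply/subsetP=> x Px; rewrite inE; apply/eqP/(gal_fix_gen r_gen) => p.
have half i : r (i, j0) = (y i + delta i) / 2 /\ r (i, j1) = (y i - delta i) / 2.
  by rewrite /ytrace /ydelta; split; field; apply: twoL.
case: p => i j; rewrite (_ : j = if j == j0 then j0 else j1); last first.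
  by case: (ord2P j) => -> //; apply: val_inj.
have [h0 h1] := half i.
case: ifP => _.
  by rewrite h0 fmorph_div rmorphD rmorph_nat /= y_fix ?d_fix.
by rewrite h1 fmorph_div rmorphB rmorph_nat /= y_fix ?d_fix.
Qed.

(** Let t generate P. As t moves y_0, the roots of the cubic are y_0, t y_0 and
    t^2 y_0, so every z in G maps delta_0 to an element x delta_0 up to sign, with x
    in P. Since z normalizes P, it maps the trace s of delta_0 under P to s or -s. So
    s^2 lies in F; as s = delta_0 + t delta_0 + t^2 delta_0, it is a root of the
    quartic sresolvent. *)
Lemma no_normal_order3 : False.
Proof.
have [t Pt ty] := order3_moves.
pose a := y i0; pose b := t a; pose c := t b.
have tc : t c = a by apply: order3_cube.
have nba : b != a by [].
have ncb : c != b by rewrite /c /b (inj_eq (fmorph_inj t)).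
have nca : c != a by apply: contra nba => /eqP e; rewrite /b -e tc e.
have a0 : cubic A%:A B%:A C%:A a = 0 by apply: cubic_y.
have V' : vieta3 A%:A B%:A C%:A a b c.
  have b0 : cubic A%:A B%:A C%:A b = 0 by apply: gal_cubic.
  have c0 : cubic A%:A B%:A C%:A c = 0 by apply: gal_cubic.
  by apply: vieta3P; rewrite // eq_sym.
have gal_ya (z : gal_of {:L}) : exists2 x, x \in P & z a = x a.
  have := gal_cubic z a0; rewrite (cubicE _ V') => /eqP.
  rewrite !mulf_eq0 !subr_eq0 => /orP[/orP[]|] /eqP->.
  - by exists 1%g; rewrite ?gal_id ?group1.
  - by exists t.
  by exists (t * t)%g; rewrite ?galM ?memvf ?groupM.
pose d := delta i0; pose s := \sum_(x in P) x d.
have s_fix x : x \in P -> \sum_(x' in P) x' (x d) = s.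
  move=> Px; rewrite /s [RHS](reindex_inj (mulgI x)) /=; apply: eq_big => z.
    by rewrite groupMl.
  by rewrite galM ?memvf.
have s2_fix z : z \in G -> z (s ^+ 2) = s ^+ 2.
  move=> Gz; have zs : z s = \sum_(x in P) x (z d).
    rewrite /s rmorph_sum /= [RHS](reindex_inj (conjg_inj z)) /=.
    apply: eq_big => x.
      by rewrite memJ_norm // (subsetP (normal_norm nP)).
    by rewrite -!galM ?memvf // conjgC.
  have [x Px e] := gal_ya z.
  have : (z d) ^+ 2 == (x d) ^+ 2.
    by rewrite -!rmorphXn /= delta_sqr !rmorphB !rmorphXn !rmorph_nat /= -/a e.
  rewrite rmorphXn /= zs eqf_sqr => /orP[]/eqP ->; first by rewrite s_fix.
  by under eq_bigr do rewrite rmorphN; rewrite sumrN s_fix // sqrrN.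
have : s ^+ 2 \in fixedField G by apply/fixedFieldP; rewrite ?memvf.
rewrite (galois_fixedField galois_1L) => /vlineP[k sk].
have nt1 : t != 1%g by apply: contra ty => /eqP ->; rewrite gal_id.
have ntt1 : (t * t)%g != 1%g.
  by apply: contra nca => /eqP e; rewrite /c /b -galM ?memvf // e gal_id.
have ntt : (t * t)%g != t.
  by rewrite -[X in _ != X]mulg1 (inj_eq (mulgI t)).
have PE : P = [set (t * t)%g; 1%g; t] :> {set _}.
  apply/eqP; rewrite eq_sym eqEcard; apply/andP; split.
    apply/subsetP=> x; rewrite !inE => /orP[/orP[]|] /eqP->;
    by rewrite ?groupM ?group1.
  by rewrite cP -setUA cardsU1 cards2 !inE negb_or ntt1 ntt (eq_sym _ t) nt1.
have sE : s = d + t d + t (t d).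
  rewrite /s PE -setUA !big_setU1 ?big_set1 /= ?gal_id ?galM ?memvf //.
  - by rewrite addrC.
  - by rewrite inE eq_sym.
  by rewrite !inE negb_or ntt1.
have d2 : d ^+ 2 = a ^+ 2 - 4 by rewrite delta_sqr.
have t2 : (t d) ^+ 2 = b ^+ 2 - 4.
  by rewrite -rmorphXn /= delta_sqr rmorphB rmorphXn rmorph_nat.
have tt2 : (t (t d)) ^+ 2 = c ^+ 2 - 4.
  by rewrite -rmorphXn /= t2 rmorphB rmorphXn rmorph_nat.
have /eqP := sresolventE V' d2 t2 tt2.
rewrite -sE sk.
have := rmorph_sresolvent (in_alg L) 1 A B C k; rewrite rmorph1 /= => <-.
by rewrite -in_algE fmorph_eq0 (negPf (res_no_root k)).
Qed.
End NormalThree.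

(** The order of G0 is 3, 6 or 12. Its number of Sylow 3-subgroups is 1 modulo 3 and
    not 1, which leaves only the order 12. *)
Lemma card_gal_sextic : #|G| = 48%N.
Proof.
have dvd48 : (#|G| %| 48)%N := card_gal_dvd r_inj fE r_gen r_flip.
have c0 := card_gal0.
have dvd12 : (#|G0| %| 12)%N by rewrite -(@dvdn_pmul2r 4) // -c0.
have dvd3 : (3 %| #|G0|)%N by have := dvd3_gal; rewrite c0 Gauss_dvdl.
have c3 : #|G0| \in [:: 3; 6; 12]%N.
  have : #|G0| \in [seq n <- divisors 12 | 3 %| n]%N.
    by rewrite mem_filter dvd3 -dvdn_divisors.
  by [].
have n1 : #|('Syl_3(G0))%g| != 1%N.
  apply/normal_sylowP => -[P sylP nP].
  have cP : #|P| = 3%N.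
    rewrite (card_Hall sylP) p_part.
    by move: c3; rewrite !inE => /or3P[] /eqP ->.
  (* The unique Sylow 3-subgroup is characteristic in G0, hence normal in G. *)
  apply: (@no_normal_order3 P) cP.
  by rewrite -(normal_Hall_pcore sylP nP) gFnormal_trans ?gal0_normal.
have nmod := @card_Syl_mod 3 _ [group of G0] isT.
have := @card_Syl_dvd 3 _ [group of G0].
rewrite c0; move: c3; rewrite !inE => /or3P[] /eqP -> //.
- rewrite dvdn_divisors // !inE => /orP[] /eqP e; move: nmod n1; by rewrite e.
- rewrite dvdn_divisors // !inE => /or4P[] /eqP e; move: nmod n1; by rewrite e.
Qed.
End SexticGalois.

(** * The order Z[sqrt 2, sqrt 3] and its reductions modulo primes *)

(** The elements are given by their coordinates on 1, sqrt 2, sqrt 3, sqrt 6. Binary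
    integers make the arithmetic of this ring effective. *)
Definition Z23 : Type := (Z * Z * Z * Z)%type.
HB.instance Definition _ := GRing.Zmodule.copy Z23 (Z * Z * Z * Z)%type.

Definition Z23_mk (a b c d : Z) : Z23 := (a, b, c, d).
Definition Z23_one := Z23_mk 1 0 0 0.
Definition Z23_mul (x y : Z23) : Z23 :=
  let: (a, b, c, d) := x in let: (a', b', c', d') := y in
  Z23_mk (a * a' + 2 * b * b' + 3 * c * c' + 6 * d * d')
     (a * b' + b * a' + 3 * c * d' + 3 * d * c')
     (a * c' + c * a' + 2 * b * d' + 2 * d * b')
     (a * d' + d * a' + b * c' + c * b').

Fact Z23_addE a b c d a' b' c' d' :
  Z23_mk a b c d + Z23_mk a' b' c' d' = Z23_mk (a + a') (b + b') (c + c') (d + d').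
Proof. by []. Qed.
Fact Z23_mulE a b c d a' b' c' d' : Z23_mul (Z23_mk a b c d) (Z23_mk a' b' c' d') =
  Z23_mk (a * a' + 2 * b * b' + 3 * c * c' + 6 * d * d')
     (a * b' + b * a' + 3 * c * d' + 3 * d * c')
     (a * c' + c * a' + 2 * b * d' + 2 * d * b')
     (a * d' + d * a' + b * c' + c * b').
Proof. by []. Qed.
Fact Z23_mulrnE a b c d n :
  Z23_mk a b c d *+ n = Z23_mk (a *+ n) (b *+ n) (c *+ n) (d *+ n).
Proof. by elim: n => // n IH; rewrite !mulrS IH. Qed.
Fact Z23_mkP x : {a & {b & {c & {d & x = Z23_mk a b c d}}}}.
Proof. by case: x => [[[a b] c] d]; exists a, b, c, d. Qed.

Fact Z23_mulA : associative Z23_mul.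
Proof.
move=> x y z; have [a1 [b1 [c1 [d1 ->]]]] := Z23_mkP x.
have [a2 [b2 [c2 [d2 ->]]]] := Z23_mkP y; have [a3 [b3 [c3 [d3 ->]]]] := Z23_mkP z.
by rewrite !Z23_mulE; congr Z23_mk; ring.
Qed.
Fact Z23_mulC : commutative Z23_mul.
Proof.
move=> x y; have [a1 [b1 [c1 [d1 ->]]]] := Z23_mkP x.
have [a2 [b2 [c2 [d2 ->]]]] := Z23_mkP y.
by rewrite !Z23_mulE; congr Z23_mk; ring.
Qed.
Fact Z23_mul1 : left_id Z23_one Z23_mul.
Proof.
move=> x; have [a1 [b1 [c1 [d1 ->]]]] := Z23_mkP x.
by rewrite !Z23_mulE; congr Z23_mk; ring.
Qed.
Fact Z23_mulDl : left_distributive Z23_mul +%R.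
Proof.
move=> x y z; have [a1 [b1 [c1 [d1 ->]]]] := Z23_mkP x.
have [a2 [b2 [c2 [d2 ->]]]] := Z23_mkP y; have [a3 [b3 [c3 [d3 ->]]]] := Z23_mkP z.
by rewrite !(Z23_mulE, Z23_addE); congr Z23_mk; ring.
Qed.
Fact Z23_oner_neq0 : Z23_one != 0.
Proof. by []. Qed.
HB.instance Definition _ := GRing.Zmodule_isComNzRing.Build Z23
  Z23_mulA Z23_mulC Z23_mul1 Z23_mulDl Z23_oner_neq0.

Section Eval.
Variables (T : comNzRingType) (u v : T).
Hypotheses (u2 : u ^+ 2 = 2) (v2 : v ^+ 2 = 3).

Definition Z_img : Z -> T := intr \o int_of_Z.
HB.instance Definition _ := GRing.RMorphism.copy Z_img (intr \o int_of_Z).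

(** For square roots u of 2 and v of 3 in T, the ring morphism that sends sqrt 2 to u
    and sqrt 3 to v. The two equations are arguments so that the morphism structure
    can be attached to it. *)
Definition Z23_eval of u ^+ 2 = 2 & v ^+ 2 = 3 := fun x : Z23 =>
  let: (a, b, c, d) := x in
  Z_img a + Z_img b * u + Z_img c * v + Z_img d * (u * v).

Lemma Z23_eval_mk a b c d :
  Z23_eval u2 v2 (Z23_mk a b c d) = Z_img a + Z_img b * u + Z_img c * v + Z_img d * (u * v).
Proof. by []. Qed.

Fact Z23_eval_is_zmod : zmod_morphism (Z23_eval u2 v2).
Proof.
move=> x y; have [a1 [b1 [c1 [d1 ->]]]] := Z23_mkP x.
have [a2 [b2 [c2 [d2 ->]]]] := Z23_mkP y.
have -> : Z23_mk a1 b1 c1 d1 - Z23_mk a2 b2 c2 d2 =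
  Z23_mk (a1 - a2) (b1 - b2) (c1 - c2) (d1 - d2) by [].
by rewrite !Z23_eval_mk !rmorphB; ring.
Qed.
Fact Z23_eval_is_monoid : monoid_morphism (Z23_eval u2 v2).
Proof.
split; first by rewrite Z23_eval_mk !rmorph0 rmorph1; ring.
move=> x y; have [a1 [b1 [c1 [d1 ->]]]] := Z23_mkP x.
have [a2 [b2 [c2 [d2 ->]]]] := Z23_mkP y.
rewrite [Z23_mk _ _ _ _ * _]Z23_mulE !Z23_eval_mk.
have E2 : Z_img 2 = u ^+ 2 by rewrite u2.
have E3 : Z_img 3 = v ^+ 2 by rewrite v2.
have E6 : Z_img 6 = u ^+ 2 * v ^+ 2 by rewrite u2 v2 -natrM.
move: (2 : Z) (3 : Z) (6 : Z) E2 E3 E6 => m2 m3 m6 E2 E3 E6.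
by rewrite !(rmorphD, rmorphM) /= E2 E3 E6; ring.
Qed.
HB.instance Definition _ := GRing.isZmodMorphism.Build
  Z23 T (Z23_eval u2 v2) Z23_eval_is_zmod.
HB.instance Definition _ := GRing.isMonoidMorphism.Build
  Z23 T (Z23_eval u2 v2) Z23_eval_is_monoid.
End Eval.

Section Roots.
(** Evaluation of the monic polynomial whose lower coefficients, from the constant
    one on, are listed in cs. *)
Definition monic_eval (T : comNzRingType) (cs : seq T) (x : T) : T :=
  foldr (fun c acc => acc * x + c) 1 cs.

(** The homogenization m^n P(b / m) of the monic polynomial P of degree n, written
    without division; it is b^n modulo m. *)
Fixpoint homog_eval (T : comNzRingType) (cs : seq T) (m b : T) : T :=
  if cs is c :: cs' then homog_eval cs' m b * b + m ^+ size cs * c else 1.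

Lemma homog_evalE (S T : comNzRingType) (f : {rmorphism S -> T}) cs m b a :
  f m * a = f b ->
  f (homog_eval cs m b) = f m ^+ size cs * monic_eval (map f cs) a.
Proof.
move=> e; elim: cs => [|c cs IH] /=; first by rewrite rmorph1 mulr1.
by rewrite rmorphD !rmorphM rmorphXn /= IH -e exprS; ring.
Qed.

Lemma homog_eval0 (S T : comNzRingType) (f : {rmorphism S -> T}) cs m b :
  f m = 0 -> f (homog_eval cs m b) = f b ^+ size cs.
Proof.
move=> e; elim: cs => [|c cs IH] /=; first by rewrite rmorph1.
by rewrite rmorphD !rmorphM rmorphXn /= IH e exprS mul0r mul0r addr0 exprSr.
Qed.

Variables (p : nat) (p_pr : prime p) (p6 : coprime p 6).
Variables (u v : 'F_p) (u2 : u ^+ 2 = 2) (v2 : v ^+ 2 = 3).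

Fact Nu2 : (- u) ^+ 2 = 2. Proof. by rewrite sqrrN. Qed.
Fact Nv2 : (- v) ^+ 2 = 3. Proof. by rewrite sqrrN. Qed.

Lemma Z_img_Fp_eq0 (z : Z) : Z_img 'F_p z = 0 -> exists z', z = p%:R * z'.
Proof.
move/eqP; rewrite /Z_img /= -(dvdz_pcharf (pchar_Fp p_pr)) => /dvdzP[q e].
exists (Z_of_int q); rewrite -[z]int_of_ZK e rmorphM mulrC; congr (_ * _).
by rewrite /= -[p in LHS]natn (rmorph_nat Z.of_nat).
Qed.

Lemma F6_neq0 : (6 : 'F_p) != 0.
Proof.
by rewrite -(dvdn_pcharf (pchar_Fp p_pr)) -prime_coprime.
Qed.

(** Modulo p, the ring Z[sqrt 2, sqrt 3] is a product of four copies of F_p: the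
    coordinates of x, multiplied by 4, 4 u, 4 v and 4 u v, are signed sums of the
    values of x under the four choices of signs. *)
Lemma Z23_eval_sep (x : Z23) :
    Z23_eval u2 v2 x = 0 -> Z23_eval Nu2 v2 x = 0 ->
    Z23_eval u2 Nv2 x = 0 -> Z23_eval Nu2 Nv2 x = 0 ->
  exists y, x = p%:R * y.
Proof.
have [a [b [c [d ->]]]] := Z23_mkP x => e1 e2 e3 e4.
pose E s t : 'F_p := Z_img _ a + Z_img _ b * s + Z_img _ c * t + Z_img _ d * (s * t).
have {}e1 : E u v = 0 := e1.
have {}e2 : E (- u) v = 0 := e2.
have {}e3 : E u (- v) = 0 := e3.
have {}e4 : E (- u) (- v) = 0 := e4.
have := F6_neq0; rewrite (_ : 6 = 2 * 3); last by ring.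
rewrite mulf_eq0 => /norP[n2 n3].
have nu : u != 0 by apply: contra n2; rewrite -u2 => /eqP->; rewrite expr0n.
have nv : v != 0 by apply: contra n3; rewrite -v2 => /eqP->; rewrite expr0n.
have n4 : (4 : 'F_p) != 0.
  by rewrite (_ : 4 = 2 * 2); [rewrite mulf_neq0|ring].
have z1 : 4 * Z_img _ a = E u v + E (- u) v + E u (- v) + E (- u) (- v).
  by rewrite /E; ring.
have z2 : 4 * u * Z_img _ b = E u v - E (- u) v + E u (- v) - E (- u) (- v).
  by rewrite /E; ring.
have z3 : 4 * v * Z_img _ c = E u v + E (- u) v - E u (- v) - E (- u) (- v).
  by rewrite /E; ring.
have z4 : 4 * (u * v) * Z_img _ d = E u v - E (- u) v - E u (- v) + E (- u) (- v).
  by rewrite /E; ring.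
have cancel0 (k : 'F_p) (z : Z) : k != 0 -> k * Z_img _ z = 0 -> exists z', z = p%:R * z'.
  by move=> nk /eqP; rewrite mulf_eq0 (negPf nk) => /eqP/Z_img_Fp_eq0.
move: z1 z2 z3 z4; rewrite e1 e2 e3 e4 !(addr0, subr0).
move=> /cancel0[] // a' -> /cancel0[]; rewrite ?mulf_neq0 // => b' ->.
move=> /cancel0[]; rewrite ?mulf_neq0 // => c' -> /cancel0[]; rewrite ?mulf_neq0 // => d' ->.
exists (Z23_mk a' b' c' d').
by rewrite !mulr_natl Z23_mulrnE.
Qed.

Variables (K : fieldType) (s2 s3 : K).
Hypotheses (s22 : s2 ^+ 2 = 2) (s32 : s3 ^+ 2 = 3).
Hypothesis ev_inj : forall x, Z23_eval s22 s32 x = 0 -> x = 0.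
Hypothesis ev_frac : forall a : K, exists m b, (0 < m)%N /\ m%:R * a = Z23_eval s22 s32 b.
Hypothesis K_char : [pchar K] =i pred0.

(** Write a = b / m. While p divides m, the equation gives b^n = 0 under all four
    reductions, so p divides b and the fraction can be simplified. Once p does not
    divide m, the fraction can be reduced modulo p. *)
Lemma root_modp (cs : seq Z23) (a : K) : (0 < size cs)%N ->
  monic_eval (map (Z23_eval s22 s32) cs) a = 0 ->
  exists x : 'F_p, monic_eval (map (Z23_eval u2 v2) cs) x = 0.
Proof.
move=> cs_gt0 a_root.
have hm0 (m : nat) b : m%:R * a = Z23_eval s22 s32 b -> homog_eval cs m%:R b = 0.
  move=> e; apply: ev_inj; rewrite (@homog_evalE _ _ (Z23_eval s22 s32) _ _ _ a).
    by rewrite a_root mulr0.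
  by rewrite rmorph_nat.
have [m [b [m0 e]]] : exists m b, (m%:R : 'F_p) != 0 /\ m%:R * a = Z23_eval s22 s32 b.
  have [m [b [m0 e]]] := ev_frac a.
  elim/ltn_ind: m b m0 e => m IH b m_gt0 e.
  have [pm|] := boolP (p %| m)%N; last first.
    by rewrite (dvdn_pcharf (pchar_Fp p_pr)) => nm; exists m, b.
  have [m' em] := dvdnP pm.
  have m0 (f : {rmorphism Z23 -> 'F_p}) : f b = 0.
    have fm : f m%:R = 0.
      by apply/eqP; rewrite rmorph_nat -(dvdn_pcharf (pchar_Fp p_pr)).
    have /esym/eqP := homog_eval0 cs b fm.
    by rewrite hm0 // rmorph0 expf_eq0 => /andP[_ /eqP].
  have [||||b' eb] := @Z23_eval_sep b; rewrite ?m0 //.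
  apply: (IH m' _ b').
  - by rewrite em ltn_Pmulr ?prime_gt1 //; move: m_gt0; rewrite em muln_gt0 => /andP[].
  - by move: m_gt0; rewrite em muln_gt0 => /andP[].
  have np : (p%:R : K) != 0.
    by apply/negP => p0; have := K_char p; rewrite !inE p_pr p0.
  by apply: (mulfI np); rewrite mulrA -natrM mulnC -em e eb rmorphM rmorph_nat.
exists (Z23_eval u2 v2 b / m%:R).
have := @homog_evalE _ _ (Z23_eval u2 v2) cs m%:R b (Z23_eval u2 v2 b / m%:R).
rewrite rmorph_nat hm0 // rmorph0 mulrC divfK // => /(_ erefl)/esym/eqP.
by rewrite mulf_eq0 expf_eq0 (negPf m0) andbF => /eqP.
Qed.
End Roots.

(** * Nonexistence of roots modulo 23 and 47 *)

Section Coefs.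
Variable T : comNzRingType.
Implicit Types k A B C x : T.
(** The coefficient lists, in the convention of monic_eval, of the polynomials to be
    shown to have no root. *)
Definition cubic_coefs A B C := [:: C; B; A].
Definition sqr_coefs (c : T) := [:: - c; 0].
Definition sres_coefs k A B C :=
  let t := dsum k A B in let h := t ^+ 2 - 4 * dsum2 k A B C in
  [:: h ^+ 2; - (4 * t * h + 64 * dprod k A B C); 4 * t ^+ 2 + 2 * h; - (4 * t)].

Lemma monic_eval_cubic A B C x : monic_eval (cubic_coefs A B C) x = cubic A B C x.
Proof. by rewrite /= /cubic; ring. Qed.
Lemma monic_eval_sqr c x : monic_eval (sqr_coefs c) x = x ^+ 2 - c.
Proof. by rewrite /=; ring. Qed.
Lemma monic_eval_sres k A B C x : monic_eval (sres_coefs k A B C) x = sresolvent k A B C x.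
Proof. by rewrite /= /sresolvent; ring. Qed.
End Coefs.

Section CoefsMorph.
Variables (S T : comNzRingType) (g : {rmorphism S -> T}).
Lemma map_cubic_coefs A B C : map g (cubic_coefs A B C) = cubic_coefs (g A) (g B) (g C).
Proof. by []. Qed.
Lemma map_sqr_coefs c : map g (sqr_coefs c) = sqr_coefs (g c).
Proof. by rewrite /= rmorphN rmorph0. Qed.
Lemma map_sres_coefs k A B C :
  map g (sres_coefs k A B C) = sres_coefs (g k) (g A) (g B) (g C).
Proof.
rewrite /sres_coefs /= /dprod /dsum /dsum2 /cubic.
by congr [:: _; _; _; _]; ring.
Qed.
End CoefsMorph.

(** The coefficients of the cubic with roots 6 y_i for the sextic f. *)
Definition scaledA := Z23_mk (-3) 0 (-2) 0.
Definition scaledB := Z23_mk (-120) (-12) 6 (-6).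
Definition scaledC := Z23_mk 216 108 216 72.

(** The places send (sqrt 2, sqrt 3) to (5, 7) modulo 23 and to (7, 12) modulo 47.
    Two of them are needed: where g is irreducible modulo p, its discriminant is a
    square modulo p. *)
Section Places.
Fact pr23 : prime 23. Proof. by []. Qed.
Fact pr47 : prime 47. Proof. by []. Qed.
Fact u23 : (5 : 'F_23) ^+ 2 = 2. Proof. exact/val_inj. Qed.
Fact v23 : (7 : 'F_23) ^+ 2 = 3. Proof. exact/val_inj. Qed.
Fact u47 : (7 : 'F_47) ^+ 2 = 2. Proof. exact/val_inj. Qed.
Fact v47 : (12 : 'F_47) ^+ 2 = 3. Proof. exact/val_inj. Qed.
Local Notation e23 := (Z23_eval u23 v23).
Local Notation e47 := (Z23_eval u47 v47).

Lemma Fp_forall p (P : pred 'F_p) : prime p ->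
  all (fun n => P n%:R) (iota 0 p) -> forall x, P x.
Proof.
move=> p_pr /allP h x; rewrite -[x]natr_Zp; apply: h.
by rewrite mem_iota add0n /=; have := ltn_ord x; rewrite {2}Fp_cast.
Qed.

Lemma place_cubic x : cubic (e23 scaledA) (e23 scaledB) (e23 scaledC) x != 0.
Proof. by apply: (@Fp_forall 23 (fun x => cubic _ _ _ x != 0) pr23); vm_compute. Qed.

Lemma place_disc x : x ^+ 2 - cdisc (e47 scaledA) (e47 scaledB) (e47 scaledC) != 0.
Proof. by apply: (@Fp_forall 47 (fun x => x ^+ 2 - _ != 0) pr47); vm_compute. Qed.

Lemma place_dprod x : x ^+ 2 - dprod 6 (e47 scaledA) (e47 scaledB) (e47 scaledC) != 0.
Proof. by apply: (@Fp_forall 47 (fun x => x ^+ 2 - _ != 0) pr47); vm_compute. Qed.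

Lemma place_discdprod x :
  x ^+ 2 - cdisc (e23 scaledA) (e23 scaledB) (e23 scaledC) *
    dprod 6 (e23 scaledA) (e23 scaledB) (e23 scaledC) != 0.
Proof. by apply: (@Fp_forall 23 (fun x => x ^+ 2 - _ != 0) pr23); vm_compute. Qed.

Lemma place_sres x : sresolvent 6 (e47 scaledA) (e47 scaledB) (e47 scaledC) x != 0.
Proof. by apply: (@Fp_forall 47 (fun x => sresolvent _ _ _ _ x != 0) pr47); vm_compute. Qed.
End Places.

(** * The field Q(sqrt 2, sqrt 3) *)

(** In w^2 = n the p-adic valuation of n would be even. *)
Lemma rat_nsq (n p : nat) (w : rat) : prime p -> logn p n = 1%N -> w ^+ 2 != n%:R.
Proof.
move=> p_pr ln; apply/eqP=> e.
have : (numq w ^+ 2)%:~R = (n%:R * denq w ^+ 2)%:~R :> rat.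
  by rewrite !(rmorphXn, rmorphM) /= rmorph_nat numqE exprMn e.
move/intr_inj/(congr1 absz); rewrite abszM !abszX natz absz_nat => /(congr1 (logn p)).
have ngt0 : (0 < n)%N by case: n ln {e} => //; rewrite logn0.
have dgt0 : (0 < `|denq w|)%N by rewrite absz_gt0 denq_neq0.
rewrite lognM ?expn_gt0 ?dgt0 // !lognX ln => /(congr1 odd).
by rewrite oddD !oddM.
Qed.

Lemma rat_common_denominator (s : seq rat) :
  exists2 m, (0 < m)%N & {in s, forall q, exists z : int, m%:R * q = z%:~R}.
Proof.
elim: s => [|q s [m m0 IH]]; first by exists 1%N.
exists (`|denq q| * m)%N; first by rewrite muln_gt0 absz_gt0 denq_neq0.
have eq : `|denq q|%:R * q = (numq q)%:~R.
  by rewrite numqE mulrC pmulrn absz_denq.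
move=> q'; rewrite inE => /orP[/eqP->|/IH[z ez]].
  by exists (m%:R * numq q); rewrite natrM mulrAC eq mulrC rmorphM /= rmorph_nat.
by exists (`|denq q|%:R * z); rewrite natrM -mulrA ez rmorphM /= rmorph_nat.
Qed.

Section Field23.
Variables (K : fieldExtType rat) (s2 s3 : K).
Hypotheses (s22 : s2 ^+ 2 = 2) (s32 : s3 ^+ 2 = 3).

Fact s22A : s2 ^+ 2 = 2%:A. Proof. by rewrite s22 scaler_nat. Qed.
Fact s32A : s3 ^+ 2 = 3%:A. Proof. by rewrite s32 scaler_nat. Qed.
Fact nsq2 (w : rat) : w ^+ 2 != 2. Proof. exact: (@rat_nsq 2 2). Qed.
Fact nsq3 (w : rat) : w ^+ 2 != 3. Proof. exact: (@rat_nsq 3 3). Qed.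
Fact nsq6 (w : rat) : w ^+ 2 != 2 * 3.
Proof. by rewrite -natrM; apply: (@rat_nsq 6 2). Qed.

Lemma dim_Q23 : \dim <<1 & [:: s2; s3]>> = 4%N.
Proof.
rewrite !adjoin_cons Fadjoin_nil.
exact: (dim_biquadratic (isT : 2 != 0 :> rat) s22A s32A nsq2 nsq3 nsq6).
Qed.

Lemma Z_img_rat (z : Z) : Z_img K z = ((int_of_Z z)%:~R : rat)%:A.
Proof. by rewrite -in_algE rmorph_int. Qed.

Lemma Q23_eval_inj x : Z23_eval s22 s32 x = 0 -> x = 0.
Proof.
have [a [b [c [d ->]]]] := Z23_mkP x; rewrite Z23_eval_mk !Z_img_rat.
move/(biquadratic_free (isT : 2 != 0 :> rat) s22A s32A nsq2 nsq3 nsq6).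
have inj (z : Z) : (int_of_Z z)%:~R = 0 :> rat -> z = 0.
  by move/eqP; rewrite intr_eq0 => /eqP e; rewrite -[z]int_of_ZK e.
by case=> /inj-> /inj-> /inj-> /inj->.
Qed.

Hypothesis K_gen : <<1 & [:: s2; s3]>>%VS = {:K}%VS.

Lemma Q23_eval_frac (a : K) : exists m b, (0 < m)%N /\ m%:R * a = Z23_eval s22 s32 b.
Proof.
have : a \in <<1 & [:: s2; s3]>>%VS by rewrite K_gen memvf.
rewrite !adjoin_cons Fadjoin_nil.
case/(biquadratic_span (isT : 2 != 0 :> rat) s22A s32A nsq2 nsq3 nsq6) => q1 [q2 [q3 [q4 ->]]].
have [m m0 den] := rat_common_denominator [:: q1; q2; q3; q4].
have den' q : q \in [:: q1; q2; q3; q4] -> exists z, m%:R * q%:A = Z_img K z.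
  move=> /den[z ez]; exists (Z_of_int z).
  by rewrite Z_img_rat Z_of_intK -ez -scalerA scaler_nat mulr_natl.
have [|z1 e1] := den' q1; rewrite ?inE ?eqxx ?orbT //.
have [|z2 e2] := den' q2; rewrite ?inE ?eqxx ?orbT //.
have [|z3 e3] := den' q3; rewrite ?inE ?eqxx ?orbT //.
have [|z4 e4] := den' q4; rewrite ?inE ?eqxx ?orbT //.
exists m, (Z23_mk z1 z2 z3 z4); split=> //.
by rewrite Z23_eval_mk -e1 -e2 -e3 -e4; ring.
Qed.

Lemma Q23_pchar : [pchar K] =i pred0.
Proof. by move=> p; rewrite (pchar_lalg K) (pchar_num rat). Qed.

(** The cubic g of the sextic f is X^3 + dftA X^2 + dftB X + dftC. *)
Definition dftA : K := - (s3 / 3 + 1 / 2).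
Definition dftB : K := (- (s2 / 6) + 1 / 6) * s3 - s2 / 3 - 1 / 3 - 3.
Definition dftC : K := (s2 / 3 + 1 / 3) * s3 + s2 / 2 - 2 * dftA.

Lemma natr_neq0 n : n.+1%:R != 0 :> K.
Proof. by rewrite -(rmorph_nat (in_alg K)) fmorph_eq0 pnatr_eq0. Qed.

Local Notation eK := (Z23_eval s22 s32).

Lemma eval_scaledA : (eK : {rmorphism Z23 -> K}) scaledA = 6 * dftA.
Proof. by rewrite /scaledA [LHS]Z23_eval_mk /dftA; field; rewrite ?natr_neq0. Qed.

Lemma eval_scaledB : (eK : {rmorphism Z23 -> K}) scaledB = 6 ^+ 2 * dftB.
Proof. by rewrite /scaledB [LHS]Z23_eval_mk /dftB; field; rewrite ?natr_neq0. Qed.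

Lemma eval_scaledC : (eK : {rmorphism Z23 -> K}) scaledC = 6 ^+ 3 * dftC.
Proof. by rewrite /scaledC [LHS]Z23_eval_mk /dftC /dftA; field; rewrite ?natr_neq0. Qed.

Lemma eval_six : (eK : {rmorphism Z23 -> K}) 6 = 6. Proof. exact: rmorph_nat. Qed.

Let root23 := root_modp pr23 (isT : coprime 23 6) u23 v23 Q23_eval_inj Q23_eval_frac Q23_pchar.
Let root47 := root_modp pr47 (isT : coprime 47 6) u47 v47 Q23_eval_inj Q23_eval_frac Q23_pchar.

Lemma dft_cubic_no_root (w : K) : cubic dftA dftB dftC w != 0.
Proof.
apply/eqP=> e.
have [||x] := root23 (cs := cubic_coefs scaledA scaledB scaledC) (a := 6 * w).
- by [].
- rewrite map_cubic_coefs monic_eval_cubic eval_scaledA eval_scaledB eval_scaledC.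
  by rewrite -[RHS](mulr0 (6 ^+ 3)) -[in RHS]e /cubic; ring.
by rewrite map_cubic_coefs monic_eval_cubic; apply/eqP/place_cubic.
Qed.

Lemma dft_disc_nsq (w : K) : w ^+ 2 != cdisc dftA dftB dftC.
Proof.
apply/eqP=> e.
have [||x] := root47 (cs := sqr_coefs (cdisc scaledA scaledB scaledC)) (a := 6 ^+ 3 * w).
- by [].
- rewrite map_sqr_coefs monic_eval_sqr rmorph_cdisc
    eval_scaledA eval_scaledB eval_scaledC exprMn e /cdisc; ring.
by rewrite map_sqr_coefs monic_eval_sqr rmorph_cdisc; apply/eqP/place_disc.
Qed.

Lemma dft_dprod_nsq (w : K) : w ^+ 2 != dprod 1 dftA dftB dftC.
Proof.
apply/eqP=> e.
have [||x] := root47 (cs := sqr_coefs (dprod 6 scaledA scaledB scaledC)) (a := 6 ^+ 3 * w).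
- by [].
- rewrite map_sqr_coefs monic_eval_sqr rmorph_dprod
    eval_six eval_scaledA eval_scaledB eval_scaledC exprMn e.
  by rewrite /dprod /cubic; ring.
rewrite map_sqr_coefs monic_eval_sqr rmorph_dprod rmorph_nat.
exact/eqP/place_dprod.
Qed.

Lemma dft_discdprod_nsq (w : K) : w ^+ 2 != cdisc dftA dftB dftC * dprod 1 dftA dftB dftC.
Proof.
apply/eqP=> e.
have [||x] := root23 (cs := sqr_coefs (cdisc scaledA scaledB scaledC *
  dprod 6 scaledA scaledB scaledC)) (a := 6 ^+ 6 * w).
- by [].
- rewrite map_sqr_coefs monic_eval_sqr rmorphM rmorph_dprod rmorph_cdisc
    eval_six eval_scaledA eval_scaledB eval_scaledC.
  by rewrite exprMn e /dprod /cdisc /cubic; ring.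
rewrite map_sqr_coefs monic_eval_sqr rmorphM rmorph_dprod rmorph_cdisc rmorph_nat.
exact/eqP/place_discdprod.
Qed.

Lemma dft_sres_no_root (w : K) : sresolvent 1 dftA dftB dftC w != 0.
Proof.
apply/eqP=> e.
have [||x] := root47 (cs := sres_coefs 6 scaledA scaledB scaledC) (a := 6 ^+ 2 * w).
- by [].
- rewrite map_sres_coefs monic_eval_sres eval_six eval_scaledA eval_scaledB eval_scaledC.
  rewrite -[RHS](mulr0 (6 ^+ 8)) -[in RHS]e.
  by rewrite /sresolvent /dprod /dsum /dsum2 /cubic; ring.
rewrite map_sres_coefs monic_eval_sres rmorph_nat.
exact/eqP/place_sres.
Qed.

Lemma dftS3_poly_rsextic : dftS3_poly s2 s3 = rsextic dftA (dftB + 3) (dftC + 2 * dftA).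
Proof.
rewrite /rsextic /dftB /dftC !subrK /dftA /dftS3_poly -!mul_polyC !polyCN.
by rewrite !mulNr.
Qed.

End Field23.

(** * The characteristic polynomial *)

(** The determinant by expansion along the first row, in a form that can be evaluated
    by reduction. *)
Fixpoint laplace_det (T : comNzRingType) n (M : nat -> nat -> T) : T :=
  if n is n'.+1 then
    foldr (fun j acc =>
        M 0%N j * ((-1) ^+ j * laplace_det n' (fun i k => M i.+1 (bump j k))) + acc)
      0 (iota 0 n)
  else 1.

Lemma laplace_detE (T : comNzRingType) n (M : nat -> nat -> T) :
  \det (\matrix_(i < n, j < n) M i j) = laplace_det n M.
Proof.
elim: n M => [|n IH] M; first by rewrite det_mx00.
rewrite (expand_det_row _ ord0) [RHS]/laplace_det -/laplace_det.
have fE (F : nat -> T) s : foldr (fun j acc => F j + acc) 0 s = \sum_(j <- s) F j.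
  by elim: s => [|j s IHs]; rewrite ?big_nil ?big_cons //= IHs.
rewrite fE -[iota 0 n.+1]/(index_iota 0 n.+1) big_mkord; apply: eq_bigr => j _.
rewrite mxE /cofactor add0n -IH; congr (_ * (_ * \det _)).
by apply/matrixP=> i k; rewrite !mxE.
Qed.

(** Six times the matrix U. *)
Definition dft6 (i j : nat) : Z23 :=
  let s6 := Z23_mk 0 0 0 1 in let s3 := Z23_mk 0 0 1 0 in let z := Z23_mk 0 0 0 0 in
  let t := Z23_mk 3 0 0 0 in
  nth z (nth [::]
    [:: [:: - s6; - s6; - s6; - s6; - s6; - s6];
        [:: - s3 *+ 2; z; - t; s3; s3; t];
        [:: z; - s3 *+ 2; s3; - t; t; s3];
        [:: z; - s3 *+ 2; s3; t; - t; s3];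
        [:: - s3 *+ 2; z; t; s3; s3; - t];
        [:: - s6; s6; s6; - s6; - s6; s6]] i) j.

(** Six times the coefficients of x^4 and x^3 in f; the coefficient of x^5 is
    scaledA / 6. *)
Definition sextic_b := Z23_mk (-2) (-2) 1 (-1).
Definition sextic_c := Z23_mk 0 3 2 2.

(** The value of 6^6 f at k, for as many k as are needed to determine a polynomial of
    degree 6. *)
Lemma laplace_det_dft6 (k : nat) : (k < 7)%N ->
  laplace_det 6 (fun i j => (if i == j then 6 * k%:R else 0) - dft6 i j) =
  6 ^+ 5 * (6 * k%:R ^+ 6 + scaledA * k%:R ^+ 5 + sextic_b * k%:R ^+ 4 + sextic_c * k%:R ^+ 3 +
            sextic_b * k%:R ^+ 2 + scaledA * k%:R + 6).
Proof.
pose P (k : nat) : bool :=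
  laplace_det 6 (fun i j => (if i == j then 6 * k%:R else 0) - dft6 i j) ==
  6 ^+ 5 * (6 * k%:R ^+ 6 + scaledA * k%:R ^+ 5 + sextic_b * k%:R ^+ 4 + sextic_c * k%:R ^+ 3 +
            sextic_b * k%:R ^+ 2 + scaledA * k%:R + 6).
have : all P (iota 0 7) by vm_compute.
by move=> /allP h lk; apply/eqP/h; rewrite mem_iota.
Qed.

Section CharPoly.
Variables (K : fieldExtType rat) (s2 s3 : K).
Hypotheses (s22 : s2 ^+ 2 = 2) (s32 : s3 ^+ 2 = 3).
Local Notation eK := (Z23_eval s22 s32 : {rmorphism Z23 -> K}).

Lemma dft6E (i j : 'I_6) : eK (dft6 i j) = 6 * dftS3 s2 s3 i j.
Proof.
have e0 : eK (Z23_mk 0 0 0 0) = 0 by rewrite [LHS]Z23_eval_mk; ring.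
have e3 : eK (Z23_mk 3 0 0 0) = 3 by rewrite [LHS]Z23_eval_mk; ring.
have es3 : eK (Z23_mk 0 0 1 0) = s3 by rewrite [LHS]Z23_eval_mk; ring.
have es6 : eK (Z23_mk 0 0 0 1) = s2 * s3 by rewrite [LHS]Z23_eval_mk; ring.
have n2 : 2 != 0 :> K := natr_neq0 K 1.
have n3 : 3 != 0 :> K := natr_neq0 K 2.
have n6 : 6 != 0 :> K := natr_neq0 K 5.
rewrite mxE /dft6; move: e0 e3 es3 es6.
move: (Z23_mk 0 0 0 0) (Z23_mk 3 0 0 0) (Z23_mk 0 0 1 0) (Z23_mk 0 0 0 1).
move=> z t r3 r6 e0 e3 es3 es6.
case: i => [[|[|[|[|[|[|//]]]]]] hi]; case: j => [[|[|[|[|[|[|//]]]]]] hj];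
  rewrite [nth _ _ _]/= ?(rmorphN, rmorphMn) ?(e0, e3, es3, es6) /=;
  by field; rewrite ?n2 ?n3 ?n6.
Qed.

Lemma eval_sextic_b : eK sextic_b = 6 * (dftB s2 s3 + 3).
Proof.
by rewrite /sextic_b [LHS]Z23_eval_mk /dftB; field; rewrite (natr_neq0 K 5) (natr_neq0 K 2).
Qed.

Lemma eval_sextic_c : eK sextic_c = 6 * (dftC s2 s3 + 2 * dftA s3).
Proof.
by rewrite /sextic_c [LHS]Z23_eval_mk /dftC /dftA;
  field; rewrite (natr_neq0 K 1) (natr_neq0 K 2).
Qed.

Lemma horner_char_poly n (M : 'M[K]_n) x :
  (char_poly M).[x] = \det (x%:M - M).
Proof.
rewrite /char_poly -[_.[x]]/(horner_eval x _) -det_map_mx; congr (\det _).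
by apply/matrixP=> i j; rewrite !mxE /= /horner_eval hornerD hornerN hornerC hornerMn hornerX.
Qed.

Lemma char_poly_dftS3 : char_poly (dftS3 s2 s3) = dftS3_poly s2 s3.
Proof.
apply/eqP; rewrite -subr_eq0; apply: contraT => nz.
have := @max_poly_roots _ _ [seq (k%:R : K) | k <- iota 0 7] nz.
have -> : all (root (char_poly (dftS3 s2 s3) - dftS3_poly s2 s3))
    [seq (k%:R : K) | k <- iota 0 7].
  apply/allP => z /mapP[k]; rewrite mem_iota => lk {z}->.
  rewrite rootE hornerD hornerN horner_char_poly subr_eq0; apply/eqP.
  have n6 : 6 != 0 :> K := natr_neq0 K 5.
  apply: (mulfI (expf_neq0 6 n6)); rewrite -detZ.
  pose N (i j : nat) : Z23 := (if i == j then 6 * k%:R else 0) - dft6 i j.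
  transitivity (eK (\det (\matrix_(i < 6, j < 6) N i j))).
    rewrite -det_map_mx; congr (\det _); apply/matrixP=> i j.
    rewrite !mxE /N rmorphB dft6E mulrBr mxE; congr (_ - _).
    rewrite -val_eqE; case: (_ == _).
      by rewrite rmorphM !rmorph_nat mulr1n.
    by rewrite rmorph0 mulr0n mulr0.
  have evE (x : Z23) : eK (6 ^+ 5 * (6 * x ^+ 6 + scaledA * x ^+ 5 + sextic_b * x ^+ 4 +
        sextic_c * x ^+ 3 + sextic_b * x ^+ 2 + scaledA * x + 6)) =
      6 ^+ 5 * (6 * eK x ^+ 6 + eK scaledA * eK x ^+ 5 + eK sextic_b * eK x ^+ 4 +
        eK sextic_c * eK x ^+ 3 + eK sextic_b * eK x ^+ 2 + eK scaledA * eK x + 6) by ring.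
  rewrite laplace_detE /N laplace_det_dft6 // evE rmorph_nat.
  rewrite eval_scaledA eval_sextic_b eval_sextic_c dftS3_poly_rsextic /rsextic.
  by rewrite !hornerE /=; ring.
rewrite map_inj_uniq ?iota_uniq; last first.
  move=> a b /eqP; rewrite -!(rmorph_nat (in_alg K)) (inj_eq (fmorph_inj _)).
  by rewrite eqr_nat => /eqP.
rewrite size_map size_iota => /(_ isT isT); rewrite ltnNge => /negP[].
apply: leq_trans (size_polyD _ _) _; rewrite size_polyN size_char_poly.
by rewrite dftS3_poly_rsextic size_rsextic.
Qed.
End CharPoly.

(** * The theorem *)

Lemma dim_baseField (F0 : fieldType) (F : fieldExtType F0) (L : fieldExtType F) :
  \dim {:baseFieldType L} = (\dim {:L} * \dim {:F})%N.
Proof.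
rewrite -dim_baseVspace; congr (\dim _).
by apply/vspaceP => a; rewrite memvf mem_baseVspace; apply/esym/(memvf (a : L)).
Qed.

Theorem mainTheorem1
  (R : realType) (K : fieldExtType rat) (iota : {rmorphism K -> R})
  (s2 s3 : K)
  (iota_s2 : iota s2 = Num.sqrt 2) (iota_s3 : iota s3 = Num.sqrt 3)
  (K_gen : <<1 & [:: s2; s3]>>%VS = {:K}%VS)
  (L : splittingFieldType K)
  (L_split : splittingFieldFor 1
               (map_poly (in_alg L) (dftS3_poly s2 s3)) {:L}) :
  char_poly (dftS3 s2 s3) = dftS3_poly s2 s3 /\
  \dim {:baseFieldType L} = 192%N /\
  \dim {:L} = 48%N /\
  exists (r : 'I_3 * 'I_2 -> L)
         (phi : {morphism 'Gal({:L} / 1)%g >-> {perm 'I_3 * 'I_2}}),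
    [/\ injective r,
        map_poly (in_alg L) (dftS3_poly s2 s3) = \prod_p ('X - (r p)%:P),
        isom 'Gal({:L} / 1)%g S2wrS3 phi
      & {in 'Gal({:L} / 1)%g, forall (sigma : gal_of {:L}) p, sigma (r p) = r (phi sigma p)}].
Proof.
have s22 : s2 ^+ 2 = 2.
  by apply: (fmorph_inj iota); rewrite rmorphXn /= iota_s2 sqr_sqrtr ?rmorph_nat.
have s32 : s3 ^+ 2 = 3.
  by apply: (fmorph_inj iota); rewrite rmorphXn /= iota_s3 sqr_sqrtr ?rmorph_nat.
split; first exact: char_poly_dftS3.
rewrite dftS3_poly_rsextic in L_split *.
have [r [r_mul fE r_gen V]] := sextic_roots L_split.
have two := natr_neq0 K 1.
have cub := dft_cubic_no_root s22 s32 K_gen.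
have disc := dft_disc_nsq s22 s32 K_gen.
have dprd := dft_dprod_nsq s22 s32 K_gen.
have ddp := dft_discdprod_nsq s22 s32 K_gen.
have sres := dft_sres_no_root s22 s32 K_gen.
have cG := card_gal_sextic r_mul fE r_gen V two cub disc dprd ddp sres.
have dL : \dim {:L} = 48%N.
  by rewrite -(card_gal r_mul fE r_gen V disc dprd).
split; first by rewrite dim_baseField dL -K_gen dim_Q23.
split=> //.
have rI := r_inj r_mul V disc dprd.
exists r, (rperm_morphism rI fE); split=> //.
- exact: rperm_isom r_gen (r_flip r_mul) cG.
- by move=> x _ p; apply: rpermE.
Qed.
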